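(* Let $X$ be a hyperbolic geodesic semimetric space that satisfies (B1) and (B2) (as defined in the context). Then the geodesics diverge exponentially in $X$, i.e. $X$ has an exponential divergence function.
   Context: A semimetric on a set $X$ is a map $d\colon X\times X\to[0,\infty]$ with $d(x,y)=0$ if and only if $x=y$, and $d(x,y)\le d(x,z)+d(z,y)$ for all $x,y,z\in X$ (no symmetry required); $(X,d)$ is then a semimetric space. Put $\mathcal B^+_r(x)=\{y: d(x,y)\le r\}$ (out-ball), $\mathcal B^-_r(x)=\{y: d(y,x)\le r\}$ (in-ball); for $A\subseteq X$, $\mathcal B^{\pm}_r(A)=\bigcup_{a\in A}\mathcal B^{\pm}_r(a)$ and $d(x,A)=\inf_{a\in A}d(x,a)$. The sets $\{y: d(x,y)<r\}$ generate the forward topology of $X$, and the sets $\{y:d(y,x)<r\}$ generate the backward topology. Paths. Equip a real interval $[a,b]$ with the semimetric $d(s,t)=t-s$ if $s\le t$ and $d(s,t)=\infty$ if $s>t$. A directed path in $X$ is a map $P\colon[a,b]\to X$ that is continuous for the forward topologies and also continuous for the backward topologies; $P(a)$ is its starting point, $P(b)$ its end point. Constant (trivial) paths are allowed. Its length is $\ell(P)=\lim_{N\to\infty}\sum_{i=1}^N d(P(t_{i-1}),P(t_i))$ with $t_i=a+i(b-a)/N$. A path is identified with its image when one speaks of points on $P$ or balls around $P$. For $U,V\subseteq X$, a directed $U$-$V$ path is a directed path with starting point in $U$ and end point in $V$. An $x$-$y$ geodesic is a directed path $P$ from $x$ to $y$ with $d(P(s),P(t))=\ell(P|_{[s,t]})$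 for all $s\le t$. $X$ is geodesic if there is an $x$-$y$ geodesic for all $x,y\in X$ with $d(x,y)<\infty$. Hyperbolicity. A geodesic triangle consists of three (not necessarily distinct) points and three geodesics (the sides), one between every two of those points (in either direction). It is $\delta$-thin if, whenever $P,Q,R$ are its sides labelled so that the starting point of $P$ is the starting or end point of $Q$ and the end point of $P$ is the starting or end point of $R$, then $P\subseteq\mathcal B^+_\delta(Q)\cup\mathcal B^-_\delta(R)$. A geodesic semimetric space is $\delta$-hyperbolic if all its geodesic triangles are $\delta$-thin, and hyperbolic if it is $\delta$-hyperbolic for some $\delta\ge0$. (B1): there is a function $f\colon\mathbb R\to\mathbb R$ such that for every $x\in X$, every $r\ge0$ and all $y,z\in\mathcal B^+_r(x)$, either $d(y,z)=\infty$ or $d(y,z)\le f(r)$. (B2): the same with $\mathcal B^-_r(x)$ in place of $\mathcal B^+_r(x)$. Divergence. For an $x$-$y$ geodesic $P$ and $0\le R\le d(x,y)$, let $P^x(R)$ be the point $u$ on $P$ with $d(x,u)=R$ and $P^y(R)$ the point $v$ on $P$ with $d(v,y)=R$. A function $e\colon\mathbb R\to\mathbb R$ is a divergence function for $X$ if for all $x\in X$, all geodesics $P_1,P_2$ each of which starts or ends at $x$, and all $r,R\in\mathbb R$ (with $R$ such that $P_1^x(R)$ is defined) the following holds: if $d(P_1^x(R),P_2)>e(0)$, then every directed $P_1$-$P_2$ path that lies outside of $\mathcal B^+_{R+r}(x)\cup\mathcal B^-_{R+r}(x)$ has length more than $e(r)$. The function $e$ is exponential if it grows at least exponentially, i.e.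 there are $A>0$, $B>1$ and $r_0$ with $e(r)\ge A B^r$ for all $r\ge r_0$. Geodesics diverge exponentially in $X$ if there is an exponential divergence function for $X$. *)

(* Defs.v *)
From HB Require Import structures.
From mathcomp Require Import all_boot all_order all_algebra.
From mathcomp Require Import all_classical all_reals all_analysis.

Set Implicit Arguments.
Unset Strict Implicit.
Unset Printing Implicit Defensive.

Import Order.TTheory GRing.Theory Num.Theory.
Import numFieldNormedType.Exports.

Local Open Scope classical_set_scope.
Local Open Scope ring_scope.
Local Open Scope ereal_scope.

Record semimetric (R : realType) (X : Type) := Semimetric {
  dist :> X -> X -> \bar R;
  dist_ge0 : forall x y, 0 <= dist x y;
  dist_eq0 : forall x y, dist x y = 0 <-> x = y;
  dist_triangle : forall x y z, dist x y <= dist x z + dist z y }.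

Section Balls.
Context (R : realType) (X : Type) (d : semimetric R X).

Definition out_ball (r : R) (x : X) : set X := [set y | d x y <= r%:E].
Definition in_ball (r : R) (x : X) : set X := [set y | d y x <= r%:E].

Definition out_ball_set (r : R) (A : set X) : set X :=
  \bigcup_(a in A) out_ball r a.
Definition in_ball_set (r : R) (A : set X) : set X :=
  \bigcup_(a in A) in_ball r a.

Definition dist_set (x : X) (A : set X) : \bar R := ereal_inf (d x @` A).

End Balls.

(* Copies of X carrying the topologies with subbases the open out-balls,
   resp. the open in-balls; the subbase is indexed by itself. *)
Definition forward (R : realType) (X : Type) (d : semimetric R X) : Type := X.
Definition backward (R : realType) (X : Type) (d : semimetric R X) : Type := X.

Section Topologies.
Context (R : realType) (X : Type) (d : semimetric R X).

Definition open_out_balls : set (set X) :=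
  [set A | exists x (r : R), A = [set y | d x y < r%:E]].
Definition open_in_balls : set (set X) :=
  [set A | exists x (r : R), A = [set y | d y x < r%:E]].

HB.instance Definition _ := gen_eqMixin (forward d).
HB.instance Definition _ := gen_choiceMixin (forward d).
HB.instance Definition _ :=
  @isSubBaseTopological.Build (forward d) (set X) open_out_balls id.

HB.instance Definition _ := gen_eqMixin (backward d).
HB.instance Definition _ := gen_choiceMixin (backward d).
HB.instance Definition _ :=
  @isSubBaseTopological.Build (backward d) (set X) open_in_balls id.

End Topologies.

Section Interval.
Context (R : realType) (a b : R).

Definition itv_type : Type := {t : R | (a <= t <= b)%R}.

Definition itv_dist (s t : itv_type) : \bar R :=
  if (sval s <= sval t)%R then (sval t - sval s)%:E else +oo.

Lemma itv_dist_ge0 s t : 0 <= itv_dist s t.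
Proof. by rewrite /itv_dist; case: ifP => // st; rewrite lee_fin subr_ge0. Qed.

Lemma itv_dist_eq0 s t : itv_dist s t = 0 <-> s = t.
Proof.
rewrite /itv_dist; split=> [|->]; last by rewrite lexx subrr.
by case: ifP => // _ [] /eqP; rewrite subr_eq0 => /eqP /val_inj ->.
Qed.

Lemma itv_dist_triangle s t u : itv_dist s t <= itv_dist s u + itv_dist u t.
Proof.
rewrite /itv_dist; case: (leP (sval s) (sval u)) => su;
  case: (leP (sval u) (sval t)) => ut; rewrite ?leey//.
by rewrite (le_trans su ut) -EFinD lee_fin [leRHS]addrC subrKA.
Qed.

Definition itv_semimetric : semimetric R itv_type :=
  Semimetric itv_dist_ge0 itv_dist_eq0 itv_dist_triangle.

End Interval.

(* A map [lo, hi] -> X, represented by a function on R whose values outside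
   [lo, hi] are never used. *)
Record curve (R : realType) (X : Type) := Curve {
  lo : R;
  hi : R;
  at_ :> R -> X }.

Section Curves.
Context (R : realType) (X : Type).
Implicit Types P : curve R X.

Definition start P : X := P (lo P).
Definition finish P : X := P (hi P).
Definition image_of P : set X := [set P t | t in [set t | (lo P <= t <= hi P)%R]].
Definition subcurve P (s t : R) : curve R X := Curve s t P.
Definition subdivision P (N i : nat) : R :=
  (lo P + i%:R * (hi P - lo P) / N%:R)%R.

End Curves.

Section Geodesics.
Context (R : realType) (X : Type) (d : semimetric R X).
Implicit Types P Q : curve R X.

Definition directed_path P : Prop :=
  let p (t : itv_type (lo P) (hi P)) : X := P (sval t) in
  [/\ (lo P <= hi P)%R,
      continuous (p : forward (itv_semimetric (lo P) (hi P)) -> forward d) &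
      continuous (p : backward (itv_semimetric (lo P) (hi P)) -> backward d)].

(* This limit exists in [0, +oo] for every directed path. *)
Definition length P : \bar R :=
  limn (fun N : nat =>
    \sum_(i < N) d (P (subdivision P N i)) (P (subdivision P N i.+1))).

Definition directed_set_path (U V : set X) P : Prop :=
  [/\ directed_path P, U (start P) & V (finish P)].

Definition geodesic P : Prop :=
  directed_path P /\
  forall s t : R, (lo P <= s)%R -> (s <= t)%R -> (t <= hi P)%R ->
    d (P s) (P t) = length (subcurve P s t).

Definition geodesic_from_to (x y : X) P : Prop :=
  [/\ geodesic P, start P = x & finish P = y].

Definition geodesic_space : Prop :=
  forall x y : X, d x y < +oo -> exists P, geodesic_from_to x y P.

Definition geodesic_between (x y : X) P : Prop :=
  geodesic_from_to x y P \/ geodesic_from_to y x P.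

(* Side i is opposite to corner i. *)
Definition geodesic_triangle (corner : 'I_3 -> X) (side : 'I_3 -> curve R X)
    : Prop :=
  forall i j k : 'I_3, uniq [:: i; j; k] ->
    geodesic_between (corner j) (corner k) (side i).

Definition endpoint P (x : X) : Prop := x = start P \/ x = finish P.

Definition thin (delta : R) (side : 'I_3 -> curve R X) : Prop :=
  forall i j k : 'I_3, uniq [:: i; j; k] ->
    let P := side i in let Q := side j in let S := side k in
    endpoint Q (start P) -> endpoint S (finish P) ->
    image_of P `<=`
      out_ball_set d delta (image_of Q) `|` in_ball_set d delta (image_of S).

Definition delta_hyperbolic (delta : R) : Prop :=
  forall corner side, geodesic_triangle corner side -> thin delta side.

Definition hyperbolic : Prop :=
  exists2 delta : R, (0 <= delta)%R & delta_hyperbolic delta.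

Definition B1 : Prop :=
  exists f : R -> R, forall (x : X) (r : R), (0 <= r)%R ->
    forall y z : X, out_ball d r x y -> out_ball d r x z ->
      d y z = +oo \/ d y z <= (f r)%:E.

Definition B2 : Prop :=
  exists f : R -> R, forall (x : X) (r : R), (0 <= r)%R ->
    forall y z : X, in_ball d r x y -> in_ball d r x z ->
      d y z = +oo \/ d y z <= (f r)%:E.

(* geodesic_point P x r u : for a geodesic P starting or ending at x, the point
   P^x(r) is defined and equal to u (such a u is unique). *)
Definition geodesic_point P (x : X) (r : R) (u : X) : Prop :=
  [/\ (0 <= r)%R, r%:E <= d (start P) (finish P), image_of P u &
      (start P = x /\ d x u = r%:E) \/ (finish P = x /\ d u x = r%:E)].

Definition divergence_function (e : R -> R) : Prop :=
  forall (x : X) (P1 P2 : curve R X),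
    geodesic P1 -> geodesic P2 -> endpoint P1 x -> endpoint P2 x ->
  forall (r rho : R) (u : X), geodesic_point P1 x rho u ->
    (e 0%R)%:E < dist_set d u (image_of P2) ->
  forall Q : curve R X,
    directed_set_path (image_of P1) (image_of P2) Q ->
    image_of Q `<=`
      ~` (out_ball d (rho + r) x `|` in_ball d (rho + r) x) ->
    (e r)%:E < length Q.

Definition exponential (e : R -> R) : Prop :=
  exists A B r0 : R, [/\ (0 < A)%R, (1 < B)%R &
    forall r : R, (r0 <= r)%R -> (A * B `^ r <= e r)%R].

Definition geodesics_diverge_exponentially : Prop :=
  exists e : R -> R, divergence_function e /\ exponential e.

End Geodesics.

(* Main.v *)
Require Import Defs.
From mathcomp Require Import all_boot all_order all_algebra.
From mathcomp Require Import all_classical all_reals all_analysis.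
From mathcomp Require Import ring lra zify.

(* Geodesics are replaced by arc-length parametrised segments, for which reversing all
   arrows is a symmetry.  By (B1), resp. (B2), a short distance in one direction and a
   finite distance in the other are both short, so thinness upgrades to: each side of a
   transitive triangle is uniformly close, in either prescribed direction, to the union of
   the other two.  Bisecting a path of length at most 2^k, a segment between its ends lies
   within a radius linear in k of the path.

   Let Q be a path of length at most 2^k from p in P1 to q in P2, let gamma be a segment
   from p to q, and let u be the given point of P1.  Thinness of the triangle x, p, q puts
   u near P2, which is excluded, or near gamma, hence within O(k) of Q, on the side
   opposite to x; as Q avoids the balls of radius R + r around x, this forces r = O(k).

   The value e(0) is both the threshold for d(u, P2) and a lower bound for the length of Q
   when r = 0.  If P1 ends at x, move along P1 from u towards x by O(k).  If P1
   starts at x, then p is boundedly close to u, and an initial part of gamma of length T is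
   boundedly close to a part of P1 of length O(k); by a pigeonhole argument T = O(k),
   after which gamma is close to P2, so that d(u, P2) = O(k) < 2^k for k large. *)

Set Implicit Arguments.
Unset Strict Implicit.
Unset Printing Implicit Defensive.

Import Order.TTheory GRing.Theory Num.Theory.
Import numFieldNormedType.Exports.

Local Open Scope classical_set_scope.
Local Open Scope ring_scope.

(** * Reversal of all arrows *)

Section Dual.
Context (R : realType) (X : Type) (d : semimetric R X).

Let dual_eq0 x y : d y x = 0%E <-> x = y.
Proof. by rewrite dist_eq0; split. Qed.

Let dual_triangle x y z : (d y x <= d z x + d y z)%E.
Proof. by rewrite addeC; exact: dist_triangle. Qed.

Definition dual : semimetric R X :=
  @Semimetric R X (fun x y => d y x) (fun x y => dist_ge0 d y x) dual_eq0 dual_triangle.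

End Dual.

(** * One-sided continuity of directed paths *)

Section Topology.
Context (R : realType) (X : Type).
Implicit Types d : semimetric R X.

Lemma distxx d x : d x x = 0%E.
Proof. by apply/dist_eq0. Qed.

Lemma ball_open d (x y : X) (r : R) : (d x y < r%:E)%E ->
  exists2 eta : R, 0 < eta & forall z, (d y z < eta%:E -> d x z < r%:E)%E.
Proof.
have := dist_ge0 d x y; case E : (d x y) => [s| |] //= _; rewrite lte_fin => sr.
exists (r - s); first by rewrite subr_gt0.
move=> z yz; apply: (le_lt_trans (dist_triangle d x z y)).
rewrite E (_ : r%:E = s%:E + (r - s)%:E)%E ?lteD2lE//.
by rewrite -EFinD; congr EFin; ring.
Qed.

(** Every subbasic ball containing [x] contains a ball centred at [x]; finite intersections follow
    by induction, keeping the smaller radius. *)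
Lemma forward_nbhsP d (x : X) (A : set X) :
  nbhs (x : forward d) (A : set (forward d)) <->
  exists2 eta : R, 0 < eta & [set y | (d x y < eta%:E)%E] `<=` A.
Proof.
rewrite nbhsE; split=> [[U [[D sD <-] [B DB Bx]] sUA]|[eta eta0 sA]].
  have [F sF FB] := sD _ DB.
  suff [eta eta0 sB] : exists2 eta : R, 0 < eta & 
      [set y | (d x y < eta%:E)%E] `<=` B.
    by exists eta => // y /sB By; apply: sUA; exists B.
  suff [eta eta0 sB] : exists2 eta : R, 0 < eta & forall C,
      C \in finmap.enum_fset F -> [set y | (d x y < eta%:E)%E] `<=` C.
    by exists eta => // y Hy; rewrite -FB => C /= CF; exact: (sB C).
  have {FB Bx} : forall C, C \in finmap.enum_fset F -> C x.
    by move: Bx; rewrite -FB => Bx C CF; exact: Bx.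
  have {sD DB sF} : forall C, C \in finmap.enum_fset F -> open_out_balls d C.
    by move=> C CF; have := sF C CF; rewrite inE.
  elim: (finmap.enum_fset F) => [|C s IH] h1 h2; first by exists 1.
  have [] := IH; [by move=> ? h; apply: h1; rewrite inE h orbT|
    by move=> ? h; apply: h2; rewrite inE h orbT|move=> eta eta0 sB].
  have [z [r Cr]] := h1 C (mem_head _ _).
  have := h2 C (mem_head _ _); rewrite Cr => /ball_open[e2 e20 h].
  exists (Num.min eta e2); first by rewrite lt_min eta0.
  move=> C'; rewrite inE => /orP[/eqP->|C's] y /= Hy.
    apply: h; apply: (lt_le_trans Hy).
    by rewrite lee_fin ge_min lexx orbT.
  apply: (sB _ C's) => /=; apply: (lt_le_trans Hy).
  by rewrite lee_fin ge_min lexx.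
exists [set y | (d x y < eta%:E)%E] => //; split.
  exists [set [set y | (d x y < eta%:E)%E]]; last by rewrite bigcup_set1.
  move=> _ ->; apply: (@finI_from1 _ _ (open_out_balls d) id).
  by exists x, eta.
by rewrite /= distxx.
Qed.

Lemma backward_nbhsP d (x : X) (A : set X) :
  nbhs (x : backward d) (A : set (backward d)) <->
  exists2 eta : R, 0 < eta & [set y | (d y x < eta%:E)%E] `<=` A.
Proof. exact: (forward_nbhsP (dual d)). Qed.

End Topology.

Section DirectedPaths.
Context (R : realType) (X : Type) (d : semimetric R X).

(* The forward topology of an interval makes this right-continuity, the backward topology
   left-continuity. *)
Definition one_sided_continuous (f : R -> X) (a b : R) : Prop :=
  forall t e, a <= t <= b -> 0 < e -> exists2 eta, 0 < eta &
    (forall s, t <= s -> s < t + eta -> s <= b -> (d (f t) (f s) < e%:E)%E) /\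
    (forall s, a <= s -> t - eta < s -> s <= t -> (d (f s) (f t) < e%:E)%E).

Lemma one_sided_continuousS f a b a' b' : a <= a' -> b' <= b ->
  one_sided_continuous f a b -> one_sided_continuous f a' b'.
Proof.
move=> aa bb h t e tab e0; have tab' : a <= t <= b by lra.
have [eta eta0 [h1 h2]] := h t e tab' e0; exists eta => //; split=> s *.
  by apply: h1 => //; lra.
by apply: h2 => //; lra.
Qed.

Lemma directed_pathP (P : curve R X) :
  directed_path d P <-> lo P <= hi P /\ one_sided_continuous P (lo P) (hi P).
Proof.
split=> [[lh cf cb]|[lh h]].
  split=> // t e tab e0.
  pose t' : itv_type (lo P) (hi P) := exist _ t tab.
  have /forward_nbhsP[e1 e10 h1] : nbhs (t' : forward (itv_semimetric (lo P) (hi P)))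
      [set s : itv_type (lo P) (hi P) | (d (P t) (P (sval s)) < e%:E)%E].
    by apply: (cf t' [set y | (d (P t) y < e%:E)%E]); apply/forward_nbhsP; exists e.
  have /backward_nbhsP[e2 e20 h2] : nbhs (t' : backward (itv_semimetric (lo P) (hi P)))
      [set s : itv_type (lo P) (hi P) | (d (P (sval s)) (P t) < e%:E)%E].
    by apply: (cb t' [set y | (d y (P t) < e%:E)%E]); apply/backward_nbhsP; exists e.
  exists (Num.min e1 e2); first by rewrite lt_min e10.
  split=> s hs1 hs2 hs3.
    have sab : lo P <= s <= hi P by lra.
    apply: (h1 (exist _ s sab)) => /=; rewrite /itv_dist /= hs1 lte_fin.
    by have : Num.min e1 e2 <= e1; [rewrite ge_min lexx|lra].
  have sab : lo P <= s <= hi P by lra.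
  apply: (h2 (exist _ s sab)) => /=; rewrite /itv_dist /= hs3 lte_fin.
  by have : Num.min e1 e2 <= e2; [rewrite ge_min lexx orbT|lra].
split=> //.
  move=> [t tab] A /forward_nbhsP[e e0 sA]; apply/forward_nbhsP.
  have [eta eta0 [h1 _]] := h t e tab e0; exists eta => // -[s sab] /=.
  rewrite /itv_dist /=; case: ifP => // ts; rewrite lte_fin => hs.
  by apply: sA => /=; apply: h1 => //; lra.
move=> [t tab] A /backward_nbhsP[e e0 sA]; apply/backward_nbhsP.
have [eta eta0 [_ h1]] := h t e tab e0; exists eta => // -[s sab] /=.
rewrite /itv_dist /=; case: ifP => // ts; rewrite lte_fin => hs.
by apply: sA => /=; apply: h1 => //; lra.
Qed.

End DirectedPaths.

(** The supremum of the points of [[a, b]] satisfying [S] satisfies [S] by the first closure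
    condition and cannot lie below [b] by the second. *)
Lemma real_induction (R : realType) (S : R -> Prop) (a b : R) :
  a <= b -> S a ->
  (forall c, a < c -> c <= b ->
    (forall e, 0 < e -> exists t, [/\ a <= t, c - e < t, t < c & S t]) -> S c) ->
  (forall c, a <= c -> c < b -> S c -> exists t, [/\ c < t, t <= b & S t]) ->
  S b.
Proof.
move=> ab Sa left_closed right_open.
pose A := [set t | a <= t <= b /\ S t].
have supA : has_sup A.
  by split; [exists a; rewrite /A /= lexx|exists b => t [/andP[]]].
have Ac t : A t -> t <= sup A by move=> At; apply: sup_upper_bound.
set c := sup A in Ac *.
have ac : a <= c by apply: Ac; rewrite /A /= lexx.
have cb : c <= b by apply: ge_sup; [case: supA|move=> t [/andP[]]].
have Sc : S c.
  move: ac; rewrite le_eqVlt => /orP[/eqP <- //|ac].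
  have [//|nSc] := pselect (S c).
  apply: left_closed => // e e0.
  have [t [/andP[ta tb] St] tc] := sup_adherent e0 supA.
  exists t; split => //; rewrite lt_neqAle Ac ?andbT; last by split => //; lra.
  by apply/eqP => tE; rewrite tE in St.
move: cb; rewrite le_eqVlt => /orP[/eqP <- //|cb].
have [t [ct tb St]] := right_open c ac cb Sc.
by have : t <= c; [apply: Ac; split => //; lra|lra].
Qed.

(** * Length *)

(* Convergence has to be proved: [limn] of a divergent sequence is a junk value. *)
Lemma lim_almost_monotone (R : realType) (u : nat -> R) (v : nat -> \bar R) :
  (forall n, v n = (u n)%:E) ->
  (forall n e, 0 < e ->
    exists N, forall m, (N <= m)%N -> u n - e <= u m) ->
  limn v = ereal_sup (range (EFin \o u)).
Proof.
move=> /funext vE H; rewrite {}vE.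
set V := ereal_sup _; apply: cvg_lim => //.
have uV n : ((u n)%:E <= V)%E by apply: ereal_sup_ubound; exists n.
have HV (y : R) : (y%:E < V)%E -> exists N, forall m, (N <= m)%N -> y <= u m.
  move=> /ereal_sup_gt[_ [n _ <-]] /=; rewrite lte_fin => yu.
  have [N HN] := H n (u n - y) (ltac:(lra)); exists N => m /HN; lra.
case E : V => [w| |].
- apply: cvg_EFin; first by apply: nearW.
  apply/cvgrPdist_le => e e0.
  have [N HN] := HV (w - e) (ltac:(by rewrite E lte_fin; lra)).
  exists N => // m /= /HN; have := uV m; rewrite E lee_fin => ??.
  by rewrite ler_norml; lra.
- apply/cvgeyPge => A.
  have [N HN] := HV A (ltac:(by rewrite E ltry)).
  by exists N => // m /= /HN; rewrite lee_fin.
- by have := uV 0%N; rewrite E.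
Qed.

Lemma small_mesh (R : realType) (x e : R) : 0 < e ->
  exists N0, forall N, (N0 <= N)%N -> (0 < N)%N /\ x / N%:R < e.
Proof.
move=> e0; exists (Num.trunc (x / e)).+1 => N H.
have N0 : (0 < N)%N by apply: leq_trans H.
split=> //; rewrite ltr_pdivrMr ?ltr0n// mulrC -ltr_pdivrMr//.
by apply: lt_le_trans (truncnS_gt _) _; rewrite ler_nat.
Qed.

Section PartitionSums.
Context (R : realType) (X : Type) (d : semimetric R X) (P : R -> X).

Let D s t := fine (d (P s) (P t)).

(** The bound [c] on single steps is an extended real, so that [+oo] admits arbitrary partitions.
    Summing through [fine] loses nothing on a one-sided continuous path, where forward distances are
    finite. *)
Inductive partition_sum (c : \bar R) (s : R) : R -> R -> Prop :=
| partition_sum0 : partition_sum c s s 0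
| partition_sumS t t' sigma : partition_sum c s t sigma -> t <= t' ->
    (d (P t) (P t') <= c)%E -> partition_sum c s t' (sigma + D t t').

Lemma partition_sum_le c s t sigma : partition_sum c s t sigma -> s <= t.
Proof. by elim=> // t0 t' sg _ st tt' _; exact: le_trans tt'. Qed.

Lemma dist_le_partition_sum (c : R) s t sigma :
  partition_sum c%:E s t sigma -> (d (P s) (P t) <= sigma%:E)%E.
Proof.
elim=> [|t0 t' sg _ IH _ h]; first by rewrite distxx.
apply: (le_trans (dist_triangle d _ _ (P t0))); rewrite EFinD.
apply: leeD => //; rewrite fineK// ge0_fin_numE ?dist_ge0//.
exact: le_lt_trans h (ltry _).
Qed.

Context (a b : R) (P_cont : one_sided_continuous d P a b).

(** Real induction on the right end: left continuity gives a short step into [t], right continuity a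
    short step out of it. *)
Lemma fine_partition (c : R) : 0 < c -> a <= b ->
  exists sigma, partition_sum c%:E a b sigma.
Proof.
move=> c0 ab.
apply: (@real_induction _ (fun t => exists sigma, partition_sum c%:E a t sigma) a b) => //.
- by exists 0; constructor.
- move=> t at_ tb H; have [] := P_cont (_ : a <= t <= b) c0; first by lra.
  move=> eta eta0 [_ h]; have [s [as_ ts st [sigma Hs]]] := H eta eta0.
  exists (sigma + D s t); apply: partition_sumS Hs _ _; first exact: ltW.
  by apply: ltW; apply: h => //; exact: ltW.
- move=> t at_ tb [sigma Hs]; have [] := P_cont (_ : a <= t <= b) c0; first by lra.
  move=> eta eta0 [h _].
  have m1 : Num.min (t + eta / 2) b <= b by rewrite ge_min lexx orbT.
  have m2 : Num.min (t + eta / 2) b <= t + eta / 2 by rewrite ge_min lexx.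
  have m3 : t < Num.min (t + eta / 2) b by rewrite lt_min tb andbT; lra.
  exists (Num.min (t + eta / 2) b); split=> //.
  exists (sigma + D t (Num.min (t + eta / 2) b)); apply: partition_sumS Hs _ _.
    exact: ltW.
  by apply: ltW; apply: h => //; [exact: ltW|lra].
Qed.

End PartitionSums.

Section Lengths.
Context (R : realType) (X : Type) (d : semimetric R X) (P : R -> X).

Let D s t := fine (d (P s) (P t)).

Lemma path_dist_fin a b s t : one_sided_continuous d P a b ->
  a <= s -> s <= t -> t <= b -> d (P s) (P t) = (D s t)%:E.
Proof.
move=> H as_ st tb; rewrite fineK// ge0_fin_numE ?dist_ge0//.
have [sigma] := fine_partition (one_sided_continuousS as_ tb H) (@ltr01 R) st.
by move=> /dist_le_partition_sum h; exact: le_lt_trans h (ltry _).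
Qed.

Context (a b : R) (P_cont : one_sided_continuous d P a b).

Let DE s t : a <= s -> s <= t -> t <= b -> d (P s) (P t) = (D s t)%:E.
Proof. exact: path_dist_fin. Qed.

Let D_ge0 s t : 0 <= D s t. Proof. exact: fine_ge0 (dist_ge0 _ _ _). Qed.

Let D_triangle s u t : a <= s -> s <= u -> u <= t -> t <= b ->
  D s t <= D s u + D u t.
Proof.
move=> as_ su ut tb; have := dist_triangle d (P s) (P t) (P u).
by rewrite !DE -?EFinD ?lee_fin//; lra.
Qed.

Context (ab : a <= b).
Let g (N i : nat) : R := subdivision (Curve a b P) N i.
Let S (N j : nat) : R := \sum_(i < j) D (g N i) (g N i.+1).

Let gS N i : g N i.+1 = g N i + (b - a) / N%:R.
Proof.
rewrite /g /subdivision /= -[in LHS]natr1; set x := N%:R; rewrite mulrDl mul1r mulrDl.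
by rewrite addrA.
Qed.

Let g0 N : g N 0 = a. Proof. by rewrite /g /subdivision /= !mul0r addr0. Qed.

Let step_ge0 N : 0 <= (b - a) / N%:R.
Proof. by rewrite divr_ge0 ?ler0n// subr_ge0. Qed.

Let g_mono N i j : (i <= j)%N -> g N i <= g N j.
Proof.
move=> /subnK <-; elim: (j - i)%N => // k IH.
by rewrite addSn gS; have := step_ge0 N; lra.
Qed.

Let gN N : (0 < N)%N -> g N N = b.
Proof.
move=> N0; rewrite /g /subdivision /= mulrAC divff ?pnatr_eq0 -?lt0n// mul1r.
by rewrite addrC subrK.
Qed.

Let g_ge N i : a <= g N i. Proof. by rewrite -(g0 N); exact: g_mono. Qed.

Let g_le N i : (i <= N)%N -> g N i <= b.
Proof.
case: N => [|N] iN; last by rewrite -(gN (ltn0Sn N)); exact: g_mono.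
by move: iN; rewrite leqn0 => /eqP ->; rewrite g0.
Qed.

Let S_add N i j : (i <= j)%N -> (j <= N)%N ->
  S N i + D (g N i) (g N j) <= S N j.
Proof.
move=> /subnK <-; elim: (j - i)%N => [|k IH] jN.
  by rewrite add0n /D distxx addr0.
rewrite addSn {2}/S big_ord_recr /= -/(S _ _).
have iki : (i <= k + i)%N by rewrite leq_addl.
have := IH (ltnW jN); have := g_mono N iki; have := g_mono N (leqnSn (k + i)).
have := g_le jN; have := g_ge N i => h1 h2 h3 h4 h5.
by have := D_triangle h1 h4 h3 h2; lra.
Qed.

Let S_mono N i j : (i <= j)%N -> (j <= N)%N -> S N i <= S N j.
Proof. by move=> ij jN; have := S_add ij jN; have := D_ge0 (g N i) (g N j); lra. Qed.

(* [d] is only finite forwards in time, so each point of the partition is approximated by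
   a subdivision point after it when leaving it and by one before it when reaching it. *)
Lemma partition_sum_approx c t sigma : partition_sum d P c a t sigma -> t <= b ->
  forall e, 0 < e -> exists N0, forall N, (N0 <= N)%N -> exists j : nat,
    [/\ (j <= N)%N, g N j <= t, t <= g N j.+1 & sigma - e <= S N j].
Proof.
elim=> [ab' e e0|{}t t' {}sigma Hs IH tt' _ tb' e e0].
  exists 0%N => N _; exists 0%N; rewrite /S big_ord0 !gS g0; split => //.
    by have := step_ge0 N; lra.
  by lra.
have at_ := partition_sum_le Hs; rewrite -/(D t t').
move: tt' tb'; rewrite le_eqVlt => /orP[/eqP <- tb'|tt' tb'].
  rewrite /D distxx /=.
  by rewrite addr0; apply: IH => //; lra.
have ba : a < b by lra.
(* Three quarters of [e] are spent: in the induction hypothesis, from [t] to the next subdivision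
   point, and from the last subdivision point to [t']. *)
have e4 : 0 < e / 4 by lra.
have tab : a <= t <= b by lra.
have tab' : a <= t' <= b by lra.
have [N1 HN1] := IH (ltac:(lra)) _ e4.
have [eta1 eta10 [h1 _]] := P_cont tab e4.
have [eta2 eta20 [_ h2]] := P_cont tab' e4.
have [N2 HN2] := small_mesh (b - a) eta10.
have [N3 HN3] := small_mesh (b - a) eta20.
have tt2 : 0 < (t' - t) / 2 by lra.
have [N4 HN4] := small_mesh (b - a) tt2.
exists (maxn (maxn N1 N2) (maxn N3 N4)) => N.
rewrite !geq_max => /andP[/andP[/HN1[j [jN gjt tgj Sj]] /HN2[N0 m1]]].
move=> /andP[/HN3[_ m2] /HN4[_ m3]].
set h := (b - a) / N%:R in m1 m2 m3 *.
have h0 : 0 < h by rewrite divr_gt0 ?ltr0n// subr_gt0.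
pose j' := Num.trunc ((t' - a) / h).
have : 0 <= (t' - a) / h by rewrite divr_ge0 ?(ltW h0)//; lra.
move=> /truncn_itv; rewrite -/j' => /andP[].
rewrite ler_pdivlMr// ltr_pdivrMr// => j'1 j'2.
have gE i : g N i = a + i%:R * h by rewrite /g /subdivision /= mulrA.
have gj'1 : g N j' <= t' by rewrite gE; lra.
have gj'2 : t' < g N j'.+1 by rewrite gE; lra.
have j'N : (j' <= N)%N.
  rewrite leqNgt; apply/negP => /(g_mono N); rewrite gS gN//.
  by rewrite -/h; lra.
move: (tgj) (gj'2); rewrite !gS -/h => tgj' gj'2'.
have jj' : (j.+1 <= j')%N.
  rewrite ltnNge; apply/negP => /(g_mono N); lra.
exists j'; split => //; first exact: ltW.
have := S_add jj' j'N.
have := S_mono (leqnSn j) (leq_trans jj' j'N).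
have gg := g_mono N jj'; have g1 := g_le j'N; have g2 := g_ge N j.+1.
have tg : g N j.+1 <= b by lra.
have gt_ : a <= g N j' by lra.
have : D t (g N j.+1) < e / 4.
  have := DE at_ tgj tg; rewrite -lte_fin => <-; apply: h1 => //.
  by rewrite gS -/h; lra.
have : D (g N j') t' < e / 4.
  have := DE gt_ gj'1 tb'; rewrite -lte_fin => <-; apply: h2 => //.
  by lra.
have gt' : g N j.+1 <= t' by lra.
have := @D_triangle t (g N j.+1) t' (ltac:(lra)) tgj gt' tb'.
have := @D_triangle (g N j.+1) (g N j') t' g2 gg gj'1 tb'.
by lra.
Qed.

Lemma partition_sum_subdivision N j : (j <= N)%N ->
  partition_sum d P +oo a (g N j) (S N j).
Proof.
elim: j => [|j IH] jN; first by rewrite g0 /S big_ord0; constructor.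
rewrite /S big_ord_recr /=; apply: partition_sumS; first exact: IH (ltnW jN).
  by rewrite gS; have := step_ge0 N; lra.
by rewrite leey.
Qed.

(** Late subdivision sums nearly dominate every partition sum. Subdivision sums are partition sums
    themselves, which gives the near monotonicity that identifies their limit with their
    supremum. *)
Lemma partition_sum_le_length c sigma :
  partition_sum d P c a b sigma -> (sigma%:E <= length d (Curve a b P))%E.
Proof.
move=> Hs.
have key c' s : partition_sum d P c' a b s -> forall e, 0 < e ->
    exists N0, forall N, (N0 <= N)%N -> s - e <= S N N.
  move=> H e e0; have [N0 HN0] := partition_sum_approx H (lexx _) e0.
  exists N0 => N /HN0[j [jN _ _ Sj]]; apply: le_trans Sj _; exact: S_mono.
rewrite /length (@lim_almost_monotone _ (fun N => S N N)); last 2 first.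
- move=> N; rewrite /S -sumEFin; apply: eq_bigr => i _.
  apply: DE; [exact: g_ge|exact: g_mono|exact: g_le].
- move=> [|N] e e0.
    (* For [N = 0] the subdivision stays at [a] and need not reach [b], so its empty sum is compared
       directly. *)
    exists 0%N => m _; rewrite {1}/S big_ord0.
    have : 0 <= S m m by apply: sumr_ge0.
    by lra.
  apply: (@key +oo%E _ _ e e0); rewrite -[X in partition_sum _ _ _ _ X _](gN (ltn0Sn N)).
  exact: partition_sum_subdivision.
apply/lee_addgt0Pr => e e0; have [N HN] := key _ _ Hs e e0.
have : ((S N N)%:E <= ereal_sup (range (EFin \o (fun N => S N N))))%E.
  by apply: ereal_sup_ubound; exists N.
have := HN N (leqnn _) => h1.
move: (ereal_sup _) => [v| |] //; rewrite -?EFinD ?lee_fin ?leey //; lra.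
Qed.

End Lengths.

(** * Arc-length parametrised geodesics *)

Definition segment (R : realType) (X : Type) (d : semimetric R X) (g : R -> X) (L : R) :=
  0 <= L /\
  forall s t, 0 <= s -> s <= t -> t <= L -> d (g s) (g t) = (t - s)%:E.

Definition trace (R : realType) (X : Type) (g : R -> X) (L : R) : set X :=
  [set g t | t in [set t | 0 <= t <= L]].

Definition joins (R : realType) (X : Type) (g : R -> X) (L : R) (x y : X) :=
  (g 0 = x /\ g L = y) \/ (g 0 = y /\ g L = x).

Definition thin_segments (R : realType) (X : Type) (d : semimetric R X) (delta : R) :=
  forall c g1 L1 g2 L2 g3 L3,
  segment d g1 L1 -> segment d g2 L2 -> segment d g3 L3 ->
  joins g2 L2 (g1 0) c -> joins g3 L3 (g1 L1) c ->
  forall t, 0 <= t <= L1 ->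
  (exists2 v, trace g2 L2 v & (d v (g1 t) <= delta%:E)%E) \/
  (exists2 v, trace g3 L3 v & (d (g1 t) v <= delta%:E)%E).

Section SegmentsGeodesics.
Context (R : realType) (X : Type) (d : semimetric R X).
Implicit Types (P : curve R X) (g : R -> X).

(** The arc length [phi] is additive because [length] dominates partition sums. Where [phi] is
    constant, so is [P]; hence any right inverse [tau] of [phi] reparametrises [P] without changing
    its image. *)
Lemma geodesic_segment P : geodesic d P ->
  exists g L, [/\ segment d g L, g 0 = start P, g L = finish P &
    image_of P = trace g L].
Proof.
case=> /directed_pathP[]; set a := lo P; set b := hi P => ab P_cont geoP.
pose D s t := fine (d (P s) (P t)).
have DE s t : a <= s -> s <= t -> t <= b -> d (P s) (P t) = (D s t)%:E.
  exact: (path_dist_fin P_cont).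
have D_ge0 s t : 0 <= D s t by exact: fine_ge0 (dist_ge0 _ _ _).
have D_add s u t : a <= s -> s <= u -> u <= t -> t <= b -> D s t = D s u + D u t.
  move=> as_ su ut tb; have st : s <= t by lra.
  apply/eqP; rewrite eq_le; apply/andP; split.
    have := dist_triangle d (P s) (P t) (P u).
    by rewrite !DE -?EFinD ?lee_fin//; lra.
  have h : partition_sum d P +oo s t (0 + D s u + D u t).
    apply: partition_sumS; rewrite ?leey//.
    by apply: partition_sumS; rewrite ?leey//; constructor.
  have := partition_sum_le_length (one_sided_continuousS as_ tb P_cont) st h.
  by have /= <- := geoP s t as_ st tb; rewrite DE// lee_fin add0r.
have D0 s t : a <= s -> s <= t -> t <= b -> D s t = 0 -> P s = P t.
  by move=> as_ st tb D0; apply/(dist_eq0 d); rewrite DE// D0.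
pose phi t := D a t.
have phi_eq s t : a <= s <= b -> a <= t <= b -> phi s = phi t -> P s = P t.
  wlog st : s t / s <= t.
    by move=> H; case: (leP s t) => [|/ltW] st ? ? ?; [|symmetry]; apply: H.
  move=> /andP[as_ _] /andP[_ tb] E; apply: D0 => //.
  by have := D_add a s t (lexx _) as_ st tb; rewrite -/(phi _) -/(phi _) E; lra.
have phi_a : phi a = 0 by rewrite /phi /D distxx.
have phi_onto v : 0 <= v <= phi b -> exists t, a <= t <= b /\ phi t = v.
  move=> /andP[v0 vb]; apply: contrapT => /forallNP nv.
  have {}nv t : a <= t <= b -> phi t != v.
    by move=> tab; apply/eqP => E; apply: (nv t).
  suff : phi b < v by lra.
  (* If the value [v] were omitted, [phi t < v] would propagate from [a] to [b] by one-sided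
     continuity. *)
  apply: (@real_induction _ (fun t => phi t < v) a b) => //.
  - by rewrite lt_neqAle phi_a v0 andbT -phi_a nv// lexx.
  - move=> c ac cb H; rewrite lt_neqAle nv ?cb ?(ltW ac)//=.
    apply/ler_addgt0Pr => e e0.
    have [] := P_cont c e _ e0; first by rewrite cb ltW.
    move=> eta eta0 [_ h]; have [t [at_ ct tc tv]] := H eta eta0.
    have := h t at_ ct (ltW tc); rewrite DE ?(ltW tc)// lte_fin => Dtc.
    by rewrite /phi (D_add a t c) ?(ltW tc) -/(phi t)//; lra.
  - move=> c ac cb cv.
    have [] := P_cont c (v - phi c) (ltac:(lra)) (ltac:(lra)).
    move=> eta eta0 [h _].
    have m1 : Num.min (c + eta / 2) b <= b by rewrite ge_min lexx orbT.
    have m2 : Num.min (c + eta / 2) b <= c + eta / 2 by rewrite ge_min lexx.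
    have m3 : c < Num.min (c + eta / 2) b by rewrite lt_min cb andbT; lra.
    exists (Num.min (c + eta / 2) b); split=> //.
    rewrite /phi (D_add a c) ?(ltW m3)// -/(phi c).
    have := h _ (ltW m3) (ltac:(lra)) m1; rewrite DE ?(ltW m3)// lte_fin.
    by lra.
have phi_ge0 : 0 <= phi b by exact: D_ge0.
have [tau tauP] : exists tau : R -> R, forall v, 0 <= v <= phi b ->
    a <= tau v <= b /\ phi (tau v) = v.
  have : forall v, exists t, 0 <= v <= phi b -> a <= t <= b /\ phi t = v.
    move=> v; case: (pselect (0 <= v <= phi b)) => [/phi_onto[t ?]|?].
      by exists t.
    by exists a.
  by move=> /choice[tau ?]; exists tau.
exists (P \o tau), (phi b); split.
- split=> // s t s0 st tb.
  have [/andP[h1 h2] h3] := tauP s (ltac:(lra)).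
  have [/andP[h4 h5] h6] := tauP t (ltac:(lra)).
  move: st; rewrite le_eqVlt => /orP[/eqP ->|st]; first by rewrite subrr distxx.
  have tst : tau s <= tau t.
    rewrite leNgt; apply/negP => tts.
    have := D_add a (tau t) (tau s) (lexx _) h4 (ltW tts) h2.
    by rewrite -/(phi _) -/(phi _) h3 h6; have := D_ge0 (tau t) (tau s); lra.
  rewrite /= DE//; congr EFin.
  have := D_add a (tau s) (tau t) (lexx _) h1 tst h5.
  by rewrite -/(phi _) -/(phi _) h3 h6; lra.
- have [? h] := tauP 0 (ltac:(lra)); apply: phi_eq; rewrite ?h//.
  by rewrite lexx.
- have [? h] := tauP (phi b) (ltac:(lra)); apply: phi_eq; rewrite ?h//.
  by rewrite lexx andbT.
- apply/seteqP; split=> [_ [t /= tab <-]|_ [v /= vb <-]]; last first.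
    by exists (tau v) => //; case: (tauP v vb).
  have pt : 0 <= phi t <= phi b.
    move/andP: tab => [at_ tb].
    have := D_add a t b (lexx _) at_ tb (lexx _).
    by have := D_ge0 a t; have := D_ge0 t b; rewrite -/(phi _) -/(phi _); lra.
  exists (phi t) => //; have [? h] := tauP _ pt.
  exact: phi_eq.
Qed.

Lemma segment_geodesic g L : segment d g L -> geodesic d (Curve 0 L g).
Proof.
move=> [L0 gP]; split.
  apply/directed_pathP; split=> //= t e /andP[t0 tL] e0; exists e => //.
  by split=> s *; rewrite gP// lte_fin; lra.
move=> s t /= s0 st tL; rewrite gP//; symmetry.
(* The sum for [N = 0] is empty; from [N = 1] on every sum equals [t - s]. *)
apply: lim_near_cst => //; exists 1%N => // N /= N0.
have Npos : (N%:R : R) > 0 by rewrite ltr0n.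
have step0 : 0 <= (t - s) / N%:R by apply: divr_ge0; [rewrite subr_ge0|exact: ltW].
transitivity (\sum_(i < N) ((t - s) / N%:R)%:E)%E; last first.
  rewrite sumEFin sumr_const card_ord; congr EFin.
  by rewrite -[LHS]mulr_natr divfK ?gt_eqF.
apply: eq_bigr => -[i iN] _; rewrite /subdivision /=.
have E j : (j <= N)%N -> 0 <= j%:R * (t - s) / N%:R <= t - s.
  move=> jN; rewrite divr_ge0 ?mulr_ge0 ?ler0n//=; last by lra.
  rewrite ler_pdivrMr// mulrC ler_wpM2l//; first by lra.
  by rewrite ler_nat.
have E1 := E _ (ltnW iN); have E2 := E _ iN.
have E3 : i.+1%:R * (t - s) / N%:R = i%:R * (t - s) / N%:R + (t - s) / N%:R.
  by rewrite -natr1 mulrDl mul1r mulrDl.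
rewrite gP; first (by congr EFin; rewrite E3; lra); lra.
Qed.

Lemma exists_segment x y : geodesic_space d -> (d x y < +oo)%E ->
  exists g L, [/\ segment d g L, g 0 = x & g L = y].
Proof.
move=> H /H[P [/geodesic_segment[g [L [? E1 E2 _]]] h1 h2]].
by exists g, L; split => //; [rewrite E1|rewrite E2].
Qed.

Lemma joins_between g L x y : segment d g L -> joins g L x y ->
  geodesic_between d x y (Curve 0 L g) /\ geodesic_between d y x (Curve 0 L g).
Proof.
move=> /segment_geodesic h.
by move=> [[? ?]|[? ?]]; split; [left|right|right|left].
Qed.

Lemma delta_hyperbolic_thin_segments delta :
  delta_hyperbolic d delta -> thin_segments d delta.
Proof.
move=> hyp c g1 L1 g2 L2 g3 L3 s1 s2 s3 j2 j3 t t1.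
(* Corner [i] has to face side [i]: [c] faces [g1], the end of [g1] faces [g2], and its start faces
   [g3]. *)
pose corner (i : 'I_3) :=
  if val i == 0%N then c else if val i == 1%N then g1 L1 else g1 0.
pose side (i : 'I_3) :=
  if val i == 0%N then Curve 0 L1 g1
  else if val i == 1%N then Curve 0 L2 g2 else Curve 0 L3 g3.
have [b1 b1'] := joins_between s1 (or_introl (conj erefl erefl)).
have [b2 b2'] := joins_between s2 j2.
have [b3 b3'] := joins_between s3 j3.
have tri : geodesic_triangle d corner side.
  move=> [[|[|[|//]]] i3] [[|[|[|//]]] j3'] [[|[|[|//]]] k3] //= _.
have := hyp corner side tri (@Ordinal 3 0 isT) (@Ordinal 3 1 isT) (@Ordinal 3 2 isT) isT.
rewrite /side /= /endpoint /start /finish /=.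
have e2 : g1 0 = g2 0 \/ g1 0 = g2 L2 by case: j2 => -[-> ->]; [left|right].
have e3 : g1 L1 = g3 0 \/ g1 L1 = g3 L3 by case: j3 => -[-> ->]; [left|right].
move=> /(_ e2 e3 (g1 t)) [].
- by exists t.
- by case=> v hv hd; left; exists v.
- by case=> v hv hd; right; exists v.
Qed.

End SegmentsGeodesics.

(** * Segments, closeness and reversal *)

Section Segments.
Context (R : realType) (X : Type).
Implicit Types (d : semimetric R X) (g : R -> X) (S : set X).

Definition has_segments d := forall x y, (d x y < +oo)%E ->
  exists g L, [/\ segment d g L, g 0 = x & g L = y].

(** This is (B1) at a fixed radius, with the alternative of infinite distance turned into a
    hypothesis. For [dual d] it is (B2). *)
Definition fan_bound d (r F : R) := forall x y z,
  (d x y <= r%:E)%E -> (d x z <= r%:E)%E -> (d y z < +oo)%E -> (d y z <= F%:E)%E.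

Definition close_to d (r : R) (x : X) S := exists2 v, S v & (d x v <= r%:E)%E.

Lemma dist_leD d x y z r s :
  (d x y <= r%:E)%E -> (d y z <= s%:E)%E -> (d x z <= (r + s)%:E)%E.
Proof.
move=> h1 h2; apply: (le_trans (dist_triangle d x z y)).
by rewrite EFinD; apply: leeD.
Qed.

Lemma dist_leW d x y r s : (d x y <= r%:E)%E -> r <= s -> (d x y <= s%:E)%E.
Proof. by move=> h rs; apply: (le_trans h); rewrite lee_fin. Qed.

Lemma dist_fin d x y r : (d x y <= r%:E)%E -> (d x y < +oo)%E.
Proof. by move=> h; apply: (le_lt_trans h); rewrite ltry. Qed.

Lemma dist_finD d x y z : (d x y < +oo)%E -> (d y z < +oo)%E -> (d x z < +oo)%E.
Proof.
by move=> h1 h2; apply: (le_lt_trans (dist_triangle d x z y)); exact: lte_add_pinfty.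
Qed.

(** Both [y] and [x] itself lie in the out-ball around [x]. *)
Lemma fan_bound_rev d r F x y : 0 <= r -> fan_bound d r F ->
  (d x y <= r%:E)%E -> (d y x < +oo)%E -> (d y x <= F%:E)%E.
Proof. by move=> r0 H xy; apply: (H x) => //; rewrite distxx lee_fin. Qed.

Lemma close_toW d r r' x S S' :
  close_to d r x S -> r <= r' -> S `<=` S' -> close_to d r' x S'.
Proof. by move=> [v Sv h] rr SS; exists v; [exact: SS|exact: dist_leW rr]. Qed.

Lemma close_to_trans d r s x y S :
  (d x y <= r%:E)%E -> close_to d s y S -> close_to d (r + s) x S.
Proof. by move=> h [v Sv h']; exists v => //; exact: dist_leD h h'. Qed.

Lemma segment_le d g L s t r : segment d g L -> 0 <= s -> s <= t -> t <= L ->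
  t - s <= r -> (d (g s) (g t) <= r%:E)%E.
Proof. by move=> [_ H] *; rewrite H// lee_fin. Qed.

Lemma segment_fin d g L s t : segment d g L -> 0 <= s -> s <= t -> t <= L ->
  (d (g s) (g t) < +oo)%E.
Proof. by move=> [_ H] *; rewrite H// ltry. Qed.

Lemma segment_ge d g L s t r : segment d g L -> 0 <= s -> s <= t -> t <= L ->
  (d (g s) (g t) <= r%:E)%E -> t - s <= r.
Proof. by move=> [_ H] s0 st tL; rewrite H// lee_fin. Qed.

Lemma subsegment d g L a b : segment d g L -> 0 <= a -> a <= b -> b <= L ->
  segment d (fun s => g (a + s)) (b - a).
Proof.
move=> [L0 H] a0 ab bL; split; first by lra.
by move=> s t s0 st tb; rewrite H; [congr EFin|..]; lra.
Qed.

Lemma initial_segment d g L b : segment d g L -> 0 <= b -> b <= L -> segment d g b.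
Proof. by move=> [L0 H] b0 bL; split=> // s t s0 st tb; rewrite H//; lra. Qed.

Lemma trace_subsegment g L a b : 0 <= a -> b <= L ->
  trace (fun s => g (a + s)) (b - a) `<=` trace g L.
Proof. by move=> a0 bL _ [s /= sab <-]; exists (a + s) => //=; lra. Qed.

Lemma trace_initial g L b : b <= L -> trace g b `<=` trace g L.
Proof. by move=> bL _ [s /= sab <-]; exists s => //=; lra. Qed.

Definition reverse g (L : R) : R -> X := fun s => g (L - s).

Lemma segment_reverse d g L : segment d g L -> segment (dual d) (reverse g L) L.
Proof.
move=> [L0 H]; split=> // s t s0 st tL.
by rewrite /= /reverse H; [congr EFin|..]; lra.
Qed.

Lemma trace_reverse g L : trace (reverse g L) L `<=` trace g L.
Proof. by move=> _ [s /= sL <-]; exists (L - s) => //=; lra. Qed.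

Lemma reverse0 g L : reverse g L 0 = g L. Proof. by rewrite /reverse subr0. Qed.
Lemma reverseL g L : reverse g L L = g 0. Proof. by rewrite /reverse subrr. Qed.

Lemma joins_ends g L x y : 0 <= L -> joins g L x y -> trace g L x /\ trace g L y.
Proof.
move=> L0.
have h0 : trace g L (g 0) by exists 0 => //=; rewrite lexx.
have h1 : trace g L (g L) by exists L => //=; rewrite L0 lexx.
by move=> [[<- <-]|[<- <-]].
Qed.

Lemma joins_reverse g L x y : joins g L x y -> joins (reverse g L) L x y.
Proof. by rewrite /joins reverse0 reverseL => -[[? ?]|[? ?]]; [right|left]. Qed.

Lemma has_segments_dual d : has_segments d -> has_segments (dual d).
Proof.
move=> H x y /H[g [L [gP g0 gL]]]; exists (reverse g L), L.
by split; rewrite ?reverse0 ?reverseL//; exact: segment_reverse.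
Qed.

(** Reversing [g1] exchanges its ends, hence the roles of [g2] and [g3], just as duality exchanges
    out-balls and in-balls. *)
Lemma thin_segments_dual d delta :
  thin_segments d delta -> thin_segments (dual d) delta.
Proof.
move=> H c g1 L1 g2 L2 g3 L3 s1 s2 s3 j2 j3 t t1.
have t1' : 0 <= L1 - t <= L1 by lra.
have := H c _ _ _ _ _ _ (segment_reverse s1) (segment_reverse s3) (segment_reverse s2).
rewrite reverse0 reverseL => /(_ (joins_reverse j3) (joins_reverse j2) _ t1').
rewrite /reverse subKr => -[] [v /trace_reverse vP h]; [right|left]; by exists v.
Qed.

End Segments.

(** * Thin triangles *)

Section Hyperbolic.
Context (R : realType) (X : Type) (d : semimetric R X) (delta F : R).
Context (delta_ge0 : 0 <= delta) (F_ge0 : 0 <= F).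
Context (geo : has_segments d) (thin : thin_segments d delta).
Context (fan : fan_bound d (2 * delta) F).
Implicit Types (p q g h : R -> X) (S Z : set X).

(** The part [3 * delta + F] comes from [shadow_or_near], the 1 from stepping strictly beyond it,
    and the last [delta] from thinness. *)
Definition spread := 4 * delta + F + 1.

(* Compare [q t] with the point of [p] at distance [t + delta] from the common origin:
   thinness bounds its distance from [q], and the choice of [t + delta] puts the nearby point of
   [q] after [q t]. *)
Lemma shadow_or_near p (Lp : R) q (Lq sw tw t : R) : segment d p Lp -> segment d q Lq ->
  p 0 = q 0 -> 0 <= sw <= Lp -> tw <= Lq -> (d (p sw) (q tw) <= delta%:E)%E ->
  0 <= t <= tw -> close_to d (3 * delta + F) (q t) (trace p Lp) \/ tw - t <= (3 * delta + F).
Proof.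
have [d_ge0 f_ge0] : 0 <= delta /\ 0 <= F by [].
move=> sp sq pq /andP[sw0 swL] twL pqd /andP[t0 ttw].
have [tKt|tKt] := lerP (tw - t) (3 * delta + F); [by right|left].
have [m [Lm [sm m0 mL]]] := geo (dist_fin pqd).
have Lm_ge0 : 0 <= Lm by case: sm.
have Lmd : Lm <= delta.
  have := segment_ge (r := delta) sm (lexx _) Lm_ge0 (lexx _).
  by rewrite m0 mL subr0; apply.
have [s sE] : exists s : R, s = t + delta by exists (t + delta).
have tsw : tw <= sw + delta.
  rewrite -[X in X <= _](subr0 tw); apply: (segment_ge sq) => //; first by lra.
  apply: (dist_leD (y := p sw)) pqd.
  by rewrite -pq; apply: (segment_le sp); lra.
have ssw : s <= sw by lra.
have s0 : 0 <= s by lra.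
have sp' := initial_segment sp sw0 swL.
have tw0 : 0 <= tw by lra.
have sq' := initial_segment sq tw0 twL.
have m_end v : trace m Lm v -> (d v (q tw) <= delta%:E)%E.
  by move=> [z /= zL <-]; rewrite -mL; apply: (segment_le sm); lra.
have near_end x y : trace m Lm y -> (d x y <= delta%:E)%E ->
    (d x (q tw) <= (2 * delta)%:E)%E.
  move=> ym xy; apply: (dist_leW (dist_leD xy (m_end y ym))); lra.
have d2 : delta <= 2 * delta by lra.
have d20 : 0 <= 2 * delta by lra.
have s_le r : (d (p s) (q tw) <= r%:E)%E -> tw <= s + r.
  move=> h; rewrite -[X in X <= _](subr0 tw); apply: (segment_ge sq) => //.
  by apply: (dist_leD (y := p s)) h; rewrite -pq; apply: (segment_le sp); lra.
have ps_fin : (d (p s) (q tw) < +oo)%E.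
  apply: (dist_finD (y := p sw)); last exact: dist_fin pqd.
  by apply: (segment_fin sp) => //; lra.
(* If [p s] were close to [m] instead of [q], then [tw <= s + 2 * delta], contrary to [tKt]. *)
have := thin (c := q tw) sp' sq' sm.
move=> /(_ (or_introl (conj (esym pq) erefl)) (or_introl (conj m0 mL))).
move=> /(_ s (ltac:(lra))) [[_ [t' /= t'tw <-] qp]|[v vm psv]]; last first.
  by have := s_le _ (near_end _ _ vm psv); lra.
have stt' : s <= t' + delta.
  rewrite -[X in X <= _](subr0 s); apply: (segment_ge sp) => //; first by lra.
  by apply: (dist_leD (y := q t')) qp; rewrite pq; apply: (segment_le sq); lra.
have tt' : t <= t' by lra.
suff t'_le : t' <= t + 2 * delta + F.
  exists (p s); first by exists s => //=; lra.
  apply: (@dist_leW _ _ _ _ _ ((2 * delta + F) + delta)); last by lra.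
  by apply: (dist_leD (y := q t')) qp; apply: (segment_le sq); lra.
(* If [q t'] is close to [p], this bounds [t'], whether the nearby point lies before or after [p s].
   If it is close to [m], the fan at [q t'] bounds the distance from [p s] to [q tw], again contrary
   to [tKt]. *)
have := thin (c := p sw) sq' sp' sm.
move=> /(_ (or_introl (conj pq erefl)) (or_intror (conj m0 mL))).
move=> /(_ t' t'tw) [[_ [s' /= s'sw <-] pq']|[v vm qv]].
  have [ss'|ss'] := lerP s s'.
    have : (d (p s) (q t') <= F%:E)%E.
      apply: (fan_bound_rev d20 fan); first exact: dist_leW d2.
      by apply: (dist_finD (y := p s')); [apply: (segment_fin sp); lra|exact: dist_fin pq'].
    move=> h; have : t' - 0 <= s + F.
      apply: (segment_ge sq); [by []|lra|lra|].
      by apply: (dist_leD (y := p s)) h; rewrite -pq; apply: (segment_le sp); lra.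
    by lra.
  have : t' - 0 <= s' + delta.
    apply: (segment_ge sq); [by []|lra|lra|].
    by apply: (dist_leD (y := p s')) pq'; rewrite -pq; apply: (segment_le sp); lra.
  by lra.
have h := fan (dist_leW qp d2) (near_end _ _ vm qv) ps_fin.
by have := s_le _ h; lra.
Qed.

(** Thinness gives arrows from [p] into [q], whereas arrows out of [q t] are wanted. Look ahead to
    [q tw]: if it is close to [S], so is [q t]; if it is reached from [p], then [shadow_or_near]
    applies, and [tw] is too far for its second alternative. If [q] ends earlier, its end is close
    to [S]. *)
Lemma side_out_close p Lp q Lq S : segment d p Lp -> segment d q Lq -> p 0 = q 0 ->
  (forall t, 0 <= t <= Lq ->
    (exists2 v, trace p Lp v & (d v (q t) <= delta%:E)%E) \/ close_to d delta (q t) S) ->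
  close_to d delta (q Lq) S ->
  forall t, 0 <= t <= Lq ->
    close_to d spread (q t) (trace p Lp) \/ close_to d spread (q t) S.
Proof.
have [d_ge0 f_ge0] : 0 <= delta /\ 0 <= F by [].
move=> sp sq pq cover qS t tL.
pose tw := Num.min (t + (3 * delta + F) + 1) Lq.
have twL : tw <= Lq by rewrite ge_min lexx orbT.
have tw1 : tw <= t + (3 * delta + F) + 1 by rewrite ge_min lexx.
have ttw : t <= tw by rewrite le_min; lra.
have goS : close_to d delta (q tw) S -> close_to d spread (q t) S.
  move=> h; apply: (@close_toW _ _ _ (((3 * delta + F) + 1) + delta)) (@subset_refl _ S).
    by apply: close_to_trans h; apply: (segment_le sq); lra.
  by rewrite /spread; lra.
have [twE|twE] : tw = Lq \/ tw = t + (3 * delta + F) + 1.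
  by rewrite /tw; case: (leP (t + (3 * delta + F) + 1) Lq) => _; [right|left].
  by right; apply: goS; rewrite twE.
have [[_ [s /= sL <-] ps]|h] := cover tw (ltac:(lra)); last by right; exact: goS.
have := @shadow_or_near _ _ _ _ s tw t sp sq pq sL twL ps (ltac:(lra)).
case=> [h|]; last by lra.
left; apply: close_toW h _ _ => //; rewrite /spread; lra.
Qed.

Lemma trace_end g L : 0 <= L -> trace g L (g L).
Proof. by move=> L0; exists L => //=; rewrite L0 lexx. Qed.

Lemma trace_start g L : 0 <= L -> trace g L (g 0).
Proof. by move=> L0; exists 0 => //=; rewrite L0 lexx. Qed.

(** For [r], thinness already points the right way; for [q], which shares the origin of [p],
    [side_out_close] turns the arrow round. *)
Lemma transitive_triangle p Lp q Lq r Lr :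
  segment d p Lp -> segment d q Lq -> segment d r Lr ->
  p 0 = q 0 -> q Lq = r 0 -> r Lr = p Lp ->
  forall t, 0 <= t <= Lp ->
    close_to d spread (p t) (trace q Lq) \/ close_to d spread (p t) (trace r Lr).
Proof.
move=> sp sq sr pq qr rp; apply: (side_out_close sq sp) => //.
  move=> t tL; apply: (thin (c := r 0) sp sq sr) => //; [left|right].
    by rewrite pq qr.
  by rewrite rp.
by exists (r Lr); [apply: trace_end; case: sr|rewrite rp distxx lee_fin].
Qed.

(* Concatenation is a constructor, instead of appending a single step, to make the notion
   symmetric under reversal. *)
Inductive chain (Z : set X) : R -> X -> X -> Prop :=
| chain_point x : Z x -> chain Z 0 x x
| chain_step x y w : Z x -> Z y -> (d x y <= w%:E)%E -> 0 <= w <= 1 -> chain Z w x y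
| chain_cat x y z w w' : chain Z w x y -> chain Z w' y z -> chain Z (w + w') x z.

Lemma chain_ends Z w x y : chain Z w x y -> Z x /\ Z y.
Proof. by elim=> // ? ? ? ? ? _ [? _] _ []. Qed.

Lemma chain_dist Z w x y : chain Z w x y -> (d x y <= w%:E)%E.
Proof.
elim=> // [z _|? ? ? ? ? _ h1 _ h2]; first by rewrite distxx.
exact: dist_leD h1 h2.
Qed.

(** The link that crosses weight [a] is dropped, leaving a gap of distance at most 1. *)
Lemma chain_split Z w x z : chain Z w x z -> forall a, 0 <= a -> w <= a \/
  exists y y' w1 w2, [/\ chain Z w1 x y, chain Z w2 y' z, (d y y' <= 1%:E)%E,
    w1 <= a & w2 <= w - a].
Proof.
elim=> [{}x Zx a a0|{}x y {}w Zx Zy xy w01 a a0|{}x y {}z {}w w' c1 IH1 c2 IH2 a a0].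
- by left.
- have [wa|wa] := lerP w a; [by left|right].
  exists x, y, 0, 0; split=> //; [exact: chain_point|exact: chain_point| |by lra].
  by apply: (dist_leW xy); lra.
- have [wa|[y1 [y2 [w1 [w2 [h1 h2 h3 h4 h5]]]]]] := IH1 a a0; last first.
    right; exists y1, y2, w1, (w2 + w'); split=> //; last by lra.
    exact: chain_cat c2.
  have [wa'|[y1 [y2 [w1 [w2 [h1 h2 h3 h4 h5]]]]]] := IH2 (a - w) (ltac:(lra)).
    by left; lra.
  right; exists y1, y2, (w + w1), w2; split=> //; [|lra|lra].
  exact: chain_cat h1.
Qed.

(** Each halving of a chain costs two triangles; the 1 covers a single link. *)
Definition log_radius (k : nat) := 1 + 2 * spread * k%:R.

(** Induction on [k], cutting the chain at weight [2 ^+ k]. The triangle [x], [y1], [y] leads to [h]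
    or [m]; the triangle [y1], [y2], [y] leads on from [m] to the gap [m1] or to [m2]. The induction
    hypothesis handles [h] and [m2]. *)
Lemma segment_out_close_chain Z k w x y g L : chain Z w x y -> w <= 2 ^+ k ->
  segment d g L -> g 0 = x -> g L = y ->
  forall t, 0 <= t <= L -> close_to d (log_radius k) (g t) Z.
Proof.
have [d_ge0 f_ge0] : 0 <= delta /\ 0 <= F by [].
have sp0 : 0 <= spread by rewrite /spread; lra.
have radS j : log_radius j.+1 = log_radius j + 2 * spread.
  by rewrite /log_radius -natr1; ring.
elim: k w x y g L => [|k IH] w x y g L c wk sg g0 gL t tL.
  have [Zx Zy] := chain_ends c; exists y => //.
  have := chain_dist c; rewrite -g0 -gL => cd.
  apply: (segment_le sg); [lra|lra|lra|].
  have L0 : 0 <= L by lra.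
  have Lw : L - 0 <= w by apply: (segment_ge sg).
  by rewrite /log_radius mulr0; rewrite expr0 in wk; lra.
have [wk'|[y1 [y2 [w1 [w2 [c1 c2 y12 w1k w2k]]]]]] :=
    chain_split c (exprn_ge0 k (@ler0n R 2)).
  apply: close_toW (IH _ _ _ _ _ c wk' sg g0 gL t tL) _ _ => //.
  by rewrite radS; lra.
have {}w2k : w2 <= 2 ^+ k by rewrite exprS in wk; lra.
have f1 := dist_fin (chain_dist c1); have f2 := dist_fin (chain_dist c2).
have f12 := dist_fin y12.
have [h [Lh [sh h0 hL]]] := geo f1.
have [m [Lm [sm m0 mL]]] := geo (dist_finD f12 f2).
have [m1 [Lm1 [sm1 m10 m1L]]] := geo f12.
have [m2 [Lm2 [sm2 m20 m2L]]] := geo f2.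
have [] := transitive_triangle sg sh sm (ltac:(by rewrite g0 h0))
  (ltac:(by rewrite hL m0)) (ltac:(by rewrite mL gL)) tL.
  move=> [_ [s /= sL <-] gs].
  apply: close_toW (close_to_trans gs (IH _ _ _ _ _ c1 w1k sh h0 hL s sL)) _ _ => //.
  by rewrite radS; lra.
move=> [_ [s /= sL <-] gs].
have [] := transitive_triangle sm sm1 sm2 (ltac:(by rewrite m0 m10))
  (ltac:(by rewrite m1L m20)) (ltac:(by rewrite m2L mL)) sL.
  move=> [_ [s' /= s'L <-] ms].
  have [_ Zy2] := (chain_ends c1).
  exists y2; first by case: (chain_ends c2).
  apply: (@dist_leW _ _ _ _ _ (spread + (spread + 1))); last first.
    by rewrite radS /log_radius; have := mulr_ge0 sp0 (ler0n R k); lra.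
  apply: (dist_leD gs); apply: (dist_leD ms).
  have Lm10 : 0 <= Lm1 by case: sm1.
  rewrite -m1L; apply: (segment_le sm1); [lra|lra|lra|].
  have : Lm1 - 0 <= 1 by apply: (segment_ge sm1); rewrite ?m10 ?m1L.
  by lra.
move=> [_ [s' /= s'L <-] ms].
apply: close_toW (close_to_trans gs (close_to_trans ms
  (IH _ _ _ _ _ c2 w2k sm2 m20 m2L s' s'L))) _ _ => //.
by rewrite radS; lra.
Qed.

End Hyperbolic.

Lemma chain_dual (R : realType) (X : Type) (d : semimetric R X) Z w x y :
  chain d Z w x y -> chain (dual d) Z w y x.
Proof.
elim=> [{}x Zx|{}x {}y {}w *|{}x {}y z {}w w' _ IH1 _ IH2].
- exact: chain_point.
- exact: chain_step.
- by rewrite addrC; exact: chain_cat IH2 IH1.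
Qed.

Lemma segment_in_close_chain (R : realType) (X : Type) (d : semimetric R X)
    (delta F : R) Z k w x y g L :
  0 <= delta -> 0 <= F -> has_segments d -> thin_segments d delta ->
  fan_bound (dual d) (2 * delta) F ->
  chain d Z w x y -> w <= 2 ^+ k -> segment d g L -> g 0 = x -> g L = y ->
  forall t, 0 <= t <= L ->
    exists2 v, Z v & (d v (g t) <= (log_radius delta F k)%:E)%E.
Proof.
move=> d0 F0 geo thin fan c wk sg g0 gL t tL.
have tL' : 0 <= L - t <= L by lra.
have := segment_out_close_chain d0 F0 (has_segments_dual geo) (thin_segments_dual thin)
  fan (chain_dual c) wk (segment_reverse sg).
by rewrite reverse0 reverseL => /(_ gL g0 _ tL'); rewrite /close_to /reverse subKr.
Qed.

(** * Divergence *)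

Lemma linear_le_exp2 (R : realType) (a b : R) : exists k : nat, a + b * k%:R <= 2 ^+ k.
Proof.
have [m [am bm]] : exists m : nat, a <= m%:R /\ b <= m%:R.
  exists (maxn (Num.trunc a).+1 (Num.trunc b).+1).
  split; [apply: le_trans (ltW (truncnS_gt a)) _|apply: le_trans (ltW (truncnS_gt b)) _];
    by rewrite ler_nat leq_max leqnn ?orbT.
(* The estimate is [a + 4 * m * b <= m + 4 * m ^ 2 <= (2 * m + 1) ^ 2 <= 2 ^ (4 * m)]. *)
exists (4 * m)%N.
have le1 : a + b * (4 * m)%:R <= ((2 * m).+1 ^ 2)%:R.
  apply: (@le_trans _ _ (m%:R + m%:R * (4 * m)%:R)).
    by apply: lerD => //; apply: ler_wpM2r => //; rewrite ler0n.
  by rewrite -natrM -natrD ler_nat -[(_ ^ 2)%N]/(_ * _)%N; nia.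
apply: (le_trans le1); rewrite -natrX ler_nat.
rewrite (_ : 4 * m = 2 * m * 2)%N; last by lia.
by rewrite expnM leq_exp2r// ltn_expl.
Qed.

Section Divergence.
Context (R : realType) (X : Type) (d : semimetric R X) (delta : R).
Implicit Types (g h gam : R -> X) (Z : set X).

(* If [g] over an interval of length [n] shadows [gam], two of the points of [gam] at spacing
   [G + 1] are shadowed by the same unit piece of [g], against the fan bound. *)
Lemma cover_length g L gam M (n : nat) (lo G : R) :
  fan_bound d (delta + 1) G -> 0 <= G ->
  segment d g L -> segment d gam M -> n%:R * (G + 1) <= M ->
  ~ (forall s : R, 0 <= s <= n%:R * (G + 1) -> exists2 u : R,
      0 <= u <= L /\ lo <= u < lo + n%:R & (d (g u) (gam s) <= delta%:E)%E).
Proof.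
move=> fan G0 sg sgam nM cover.
pose pt (i : 'I_n.+1) : R := (val i)%:R * (G + 1).
have pt_in i : 0 <= pt i <= n%:R * (G + 1).
  rewrite /pt mulr_ge0 ?ler0n//=; last by lra.
  by apply: ler_wpM2r; [lra|rewrite ler_nat -ltnS].
have [u uP] : exists u : 'I_n.+1 -> R, forall i,
    [/\ 0 <= u i <= L, lo <= u i < lo + n%:R & (d (g (u i)) (gam (pt i)) <= delta%:E)%E].
  have : forall i, exists u : R,
      [/\ 0 <= u <= L, lo <= u < lo + n%:R & (d (g u) (gam (pt i)) <= delta%:E)%E].
    by move=> i; have [u [? ?] ?] := cover _ (pt_in i); exists u.
  by move=> /choice[u ?]; exists u.
(* The [n + 1] parameters [u i] fall into [n] unit cells, so two of them share a cell; the earlier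
   one becomes the centre of the fan. *)
have cell_lt i : (Num.trunc (u i - lo)%R < n)%N.
  by have [_ h _] := uP i; rewrite truncn_lt_nat; lra.
pose cell i : 'I_n := Ordinal (cell_lt i).
have /injectivePn[i [j ij cij]] : ~~ injectiveb cell.
  by apply/injectiveP => /leq_card; rewrite !card_ord ltnn.
wlog lt_ij : i j ij cij / (i < j)%N.
  move=> H; case: (ltngtP i j) => [lt|lt|E]; first exact: (H i j).
    by apply: (H j i) => //; rewrite eq_sym.
  by move: ij; rewrite (val_inj E) eqxx.
have [ui1 ui2 ui3] := uP i; have [uj1 uj2 uj3] := uP j.
have ui0 : 0 <= u i - lo by lra.
have uj0 : 0 <= u j - lo by lra.
have cE : Num.trunc (u i - lo) = Num.trunc (u j - lo) by case: cij.
have := truncn_itv ui0; have := truncn_itv uj0; rewrite cE -natr1 => vj vi.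
have [v [vL vi' vj']] : exists v : R,
    [/\ 0 <= v <= L, v <= u i <= v + 1 & v <= u j <= v + 1].
  have [uij|uij] := lerP (u i) (u j); [exists (u i)|exists (u j)]; split; lra.
have near t y : v <= t <= v + 1 -> 0 <= t <= L -> (d (g t) y <= delta%:E)%E ->
    (d (g v) y <= (delta + 1)%:E)%E.
  move=> tv tL ty; rewrite (addrC delta); apply: (dist_leD _ ty).
  apply: (segment_le sg); lra.
have pij : pt i + (G + 1) <= pt j.
  have : ((val i).+1%:R : R) <= (val j)%:R by rewrite ler_nat.
  rewrite /pt -natr1 => ij1.
  have G1 : 0 <= G + 1 by lra.
  by have := ler_wpM2r G1 ij1; lra.
have pi := pt_in i; have pj := pt_in j.
have fin : (d (gam (pt i)) (gam (pt j)) < +oo)%E.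
  by apply: (segment_fin sgam); lra.
have dij := fan _ _ _ (near _ _ vi' ui1 ui3) (near _ _ vj' uj1 uj3) fin.
have : pt j - pt i <= G by apply: (segment_ge sgam) dij; lra.
by lra.
Qed.

Context (F : R) (delta_ge0 : 0 <= delta) (F_ge0 : 0 <= F).
Context (geo : has_segments d) (thin : thin_segments d delta).
Context (fan : fan_bound d (2 * delta) F) (fan' : fan_bound (dual d) (2 * delta) F).

Local Notation K := (spread delta F).
Local Notation rad := (log_radius delta F).

Section Configuration.
Context (g h gam : R -> X) (L M N : R) (q : X).
Context (sg : segment d g L) (sh : segment d h M) (sgam : segment d gam N).
Context (gam_end : gam N = q).
Context (Z : set X) (w : R) (k : nat) (wk : w <= 2 ^+ k).

(** If [h] starts at [g 0], [side_out_close] applies. Otherwise [h] starts at [q], so [g t] reaches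
    each point of [h] through [g L] and [q]; being finite, the distance back is at most [F] by the
    fan bound. *)
Lemma outgoing_side_close : gam 0 = g L -> joins h M (g 0) q ->
  forall t, 0 <= t <= L ->
  close_to d K (g t) (trace h M) \/ close_to d K (g t) (trace gam N).
Proof.
have [d_ge0 f_ge0] : 0 <= delta /\ 0 <= F by [].
have dK : delta <= K by rewrite /spread; lra.
have N0 : 0 <= N by case: sgam.
have M0 : 0 <= M by case: sh.
move=> gam0 jh.
have jgam : joins gam N (g L) q by left.
have cover t : 0 <= t <= L ->
    (exists2 v, trace h M v & (d v (g t) <= delta%:E)%E) \/
    close_to d delta (g t) (trace gam N).
  by move=> tL; exact: (thin sg sh sgam jh jgam).
case: jh => [[h0 hM]|[h0 hM]] t tL.
  apply: (side_out_close delta_ge0 F_ge0 geo thin fan sh sg h0 cover) => //.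
  by exists (g L); [rewrite -gam0; exact: trace_start|rewrite distxx lee_fin].
case: (cover t tL) => [[_ [s /= sM <-] hgt]|h']; last by right; exact: close_toW h' dK _.
left; exists (h s); first by exists s.
apply: (@dist_leW _ _ _ _ _ F); last by rewrite /spread; lra.
have d20 : 0 <= 2 * delta by lra.
apply: (fan_bound_rev d20 fan); first by apply: dist_leW hgt _; lra.
apply: (dist_finD (y := g L)); first by apply: (segment_fin sg); lra.
apply: (dist_finD (y := q)); last by rewrite -h0; apply: (segment_fin sh); lra.
by rewrite -gam0 -gam_end; apply: (segment_fin sgam); lra.
Qed.

(** Were [g t] close to [gam] instead, a route from [g 0] over [g t] and [gam] would reach the chain
    within [rho]. *)
Lemma outgoing_far (rho t : R) : gam 0 = g L -> joins h M (g 0) q ->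
  chain d Z w (g L) q -> (forall z, Z z -> ~ (d (g 0) z <= rho%:E)%E) ->
  0 <= t <= L -> t + K + rad k <= rho -> close_to d K (g t) (trace h M).
Proof.
move=> gam0 jh c far tL krho.
have [//|[_ [s /= sN <-] gs]] := outgoing_side_close gam0 jh tL.
have [z Zz gz] :=
  segment_out_close_chain delta_ge0 F_ge0 geo thin fan c wk sgam gam0 gam_end sN.
case: (far z Zz); apply: dist_leW krho; apply: (dist_leD _ gz).
by apply: (dist_leD _ gs); apply: (segment_le sg); lra.
Qed.

(** Here [g] ends on [h], so thinness already points towards [h]. The alternative gives a route of
    length at most [rho] from the chain over [gam] and [g] to [g L]. *)
Lemma incoming_far (rho t : R) : gam 0 = g 0 -> joins h M (g L) q ->
  chain d Z w (g 0) q -> (forall z, Z z -> ~ (d z (g L) <= rho%:E)%E) ->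
  0 <= t <= L -> L - t + delta + rad k <= rho -> close_to d delta (g t) (trace h M).
Proof.
move=> gam0 jh c far tL krho.
have jgam : joins gam N (g 0) q by left.
have [[_ [s /= sN <-] gs]|//] := thin sg sgam sh jgam jh tL.
have [z Zz gz] :=
  segment_in_close_chain delta_ge0 F_ge0 geo thin fan' c wk sgam gam0 gam_end sN.
case: (far z Zz); apply: (@dist_leW _ _ _ _ _ (rad k + (delta + (L - t)))); last by lra.
apply: (dist_leD gz); apply: (dist_leD gs); apply: (segment_le sg); lra.
Qed.

(** Advancing along [g] by [delta + rad k] gains the slack for [incoming_far]; if [g] ends before
    that, its end lies on [h]. *)
Lemma incoming_near (t : R) : gam 0 = g 0 -> joins h M (g L) q ->
  chain d Z w (g 0) q -> (forall z, Z z -> ~ (d z (g L) <= (L - t)%:E)%E) ->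
  0 <= t <= L -> close_to d (delta + rad k + delta) (g t) (trace h M).
Proof.
have [d_ge0 f_ge0] : 0 <= delta /\ 0 <= F by [].
move=> gam0 jh c far tL.
have rad0 : 0 <= rad k.
  by rewrite /log_radius addr_ge0// mulr_ge0 ?ler0n// /spread; lra.
have [Lt|Lt] := lerP (L - t) (delta + rad k).
  have M0 : 0 <= M by case: sh.
  exists (g L); first by case: (joins_ends M0 jh).
  by apply: (segment_le sg); lra.
have tL' : 0 <= t + (delta + rad k) <= L by lra.
apply: close_to_trans (incoming_far gam0 jh c far tL' _); last by lra.
by apply: (segment_le sg); lra.
Qed.

Lemma outgoing_near (t G H : R) (n : nat) : gam 0 = g L -> joins h M (g 0) q ->
  chain d Z w (g L) q -> (forall z, Z z -> ~ (d (g 0) z <= t%:E)%E) ->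
  0 <= t <= L ->
  fan_bound d (delta + 1) G -> 0 <= G -> fan_bound (dual d) K H ->
  rad k + delta + H < n%:R -> K + n%:R * (G + 1) + delta <= 2 ^+ k ->
  close_to d (2 ^+ k) (g t) (trace h M).
Proof.
have [d_ge0 f_ge0] : 0 <= delta /\ 0 <= F by [].
move=> gam0 jh c far tL fanG G0 fanH nH nk.
have K0 : 0 <= K by rewrite /spread; lra.
have nG0 : 0 <= n%:R * (G + 1) by rewrite mulr_ge0 ?ler0n//; lra.
have N0 : 0 <= N by case: sgam.
have M0 : 0 <= M by case: sh.
have [hx hq] := joins_ends M0 jh.
have [wi|] := outgoing_side_close gam0 jh tL; first by apply: close_toW wi _ _ => //; lra.
move=> [_ [tv /= tvN <-] gtv].
have N2k : N <= 2 ^+ k.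
  have Nw : N - 0 <= w.
    by apply: (segment_ge sgam) => //; rewrite gam0 gam_end; exact: chain_dist c.
  by apply: le_trans wk; lra.
have to_q (r : R) : K + (N - tv) <= r -> close_to d r (g t) (trace h M).
  move=> rE; exists q => //; apply: dist_leW rE; apply: (dist_leD gtv).
  by rewrite -gam_end; apply: (segment_le sgam); lra.
have [tvK|tvK] := lerP K tv; first by apply: to_q; lra.
(* Both [g t] and [g L] have [gam tv] within [K], so (B2) bounds the distance between them. *)
have gtL : L - t <= H.
  apply: (segment_ge sg); [lra|lra|lra|].
  apply: (fanH (gam tv)) => /=; [|exact: gtv|apply: (segment_fin sg); lra].
  by rewrite -gam0; apply: (segment_le sgam); lra.
have [NT|NT] := ltrP N (tv + n%:R * (G + 1)); first by apply: to_q; lra.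
apply: contrapT => nclose.
have tvN' : tv <= N by lra.
have tv0 : 0 <= tv by lra.
have sgam' := subsegment sgam tv0 tvN' (lexx N).
have jg : joins g L (gam 0) (g 0) by right; rewrite gam0.
have jh' : joins h M (gam N) (g 0) by rewrite gam_end; case: jh; [right|left].
(* If [gam] stays away from [h] for length [n%:R * (G + 1)] after [tv], then [g] shadows it there.
   Since the chain is far from [g 0], the shadowing parameters exceed [t - delta - rad k]; they are
   at most [L <= t + H], so a window of length [n] contains them. *)
apply: (cover_length (n := n) (lo := t - delta - rad k) fanG G0 sg sgam'); first by lra.
move=> s sT.
have sN : 0 <= tv + s <= N by lra.
have [[_ [v /= vL <-] gv]|wi] := thin sgam sg sh jg jh' sN; last first.
  case: nclose; have sle : (d (gam tv) (gam (tv + s)) <= s%:E)%E.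
    by apply: (segment_le sgam); lra.
  by apply: close_toW (close_to_trans gtv (close_to_trans sle wi)) _ _ => //; lra.
exists v => //; split=> //.
have [z Zz gz] :=
  segment_out_close_chain delta_ge0 F_ge0 geo thin fan c wk sgam gam0 gam_end sN.
have [zv|zv] := lerP (v + delta + rad k) t; last by lra.
case: (far z Zz); apply: dist_leW zv; apply: (dist_leD _ gz).
by apply: (dist_leD _ gv); apply: (segment_le sg); lra.
Qed.

End Configuration.
End Divergence.

(** * The divergence function and the final assembly *)

Lemma exponential_truncn (R : realType) (a c : R) (e : R -> R) : 0 < c ->
  (forall r, a <= r -> e r = 2 ^+ Num.trunc ((r - a) / c)) -> exponential e.
Proof.
move=> c0 eE.
have two0 : (2 : R) != 0 by rewrite pnatr_eq0.
have ge2 : (1 : R) <= 2 by rewrite ler1n.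
(* Truncation loses less than 1, so the power of 2 with exponent [(r - a) / c - 1] is a lower
   bound. *)
exists (2 `^ (- (a / c) - 1)), (2 `^ c^-1), a; split.
- by rewrite powR_gt0.
- rewrite lt_neqAle eq_sym powR_eq1 !negb_or.
  rewrite (gt_eqF (ltr1n R 2)) ltrn0 invr_eq0 (gt_eqF c0) /=.
  by rewrite -[leLHS](powRr0 2) ler_powR// invr_ge0 ltW.
- move=> r ar; rewrite eE// -powRrM -powRD ?two0 ?implybT//.
  rewrite -powR_mulrn ?ler0n// ler_powR//.
  have := truncnS_gt ((r - a) / c); rewrite -natr1 mulrBl => h.
  by rewrite (mulrC c^-1); lra.
Qed.

Lemma partition_chain (R : realType) (X : Type) (d : semimetric R X) (P : R -> X)
    (Z : set X) (a t sigma : R) :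
  partition_sum d P 1%:E a t sigma -> (forall s, a <= s <= t -> Z (P s)) ->
  chain d Z sigma (P a) (P t).
Proof.
elim=> [ZP|{}t t' {}sigma Hs IH tt' h ZP].
  by apply: chain_point; apply: ZP; rewrite lexx.
have at_ := partition_sum_le Hs.
apply: (@chain_cat _ _ _ _ _ (P t)); first by apply: IH => s st; apply: ZP; lra.
have dfin : d (P t) (P t') \is a fin_num.
  by rewrite ge0_fin_numE ?dist_ge0// (dist_fin h).
apply: chain_step; [by apply: ZP; lra|by apply: ZP; lra|by rewrite fineK|].
by rewrite -!lee_fin fineK// dist_ge0.
Qed.

Lemma directed_path_chain (R : realType) (X : Type) (d : semimetric R X)
    (P : curve R X) : directed_path d P ->
  exists2 w, chain d (image_of P) w (start P) (finish P) & (w%:E <= length d P)%E.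
Proof.
case: P => a b P /directed_pathP[/= ab P_cont].
have [w Hw] := fine_partition P_cont (@ltr01 R) ab.
exists w; last exact: partition_sum_le_length P_cont ab _ _ Hw.
by apply: partition_chain Hw _ => s sab; exists s.
Qed.

(** The path [Q] may end in the interior of [P2], whereas the side of a triangle has to end at its
    corner. *)
Lemma segment_from_end (R : realType) (X : Type) (d : semimetric R X) g L x y :
  segment d g L -> x = g 0 \/ x = g L -> trace g L y ->
  exists h M, [/\ segment d h M, joins h M x y & trace h M `<=` trace g L].
Proof.
move=> sg [->|->] [s /= /andP[s0 sL] <-].
  exists g, s; split; [exact: initial_segment sL|by left|exact: trace_initial].
exists (fun t => g (s + t)), (L - s); split; first exact: subsegment sg s0 sL (lexx L).
  by right; rewrite addr0 addrC subrK.
exact: trace_subsegment.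
Qed.

Lemma B1_fan_bound (R : realType) (X : Type) (d : semimetric R X) : B1 d ->
  forall r, 0 <= r -> exists2 F, 0 <= F & fan_bound d r F.
Proof.
move=> [f fP] r r0; exists `|f r|; first exact: normr_ge0.
move=> x y z xy xz yz; case: (fP x r r0 y z xy xz) => [yzoo|h].
  by rewrite yzoo ltxx in yz.
by apply: dist_leW h _; exact: ler_norm.
Qed.

Lemma B2_fan_bound (R : realType) (X : Type) (d : semimetric R X) : B2 d ->
  forall r, 0 <= r -> exists2 F, 0 <= F & fan_bound (dual d) r F.
Proof.
move=> [f fP] r r0; exists `|f r|; first exact: normr_ge0.
move=> x y z xy xz zy; case: (fP x r r0 z y xz xy) => [zyoo|h].
  by rewrite /= zyoo ltxx in zy.
by apply: (@dist_leW _ _ d) h _; exact: ler_norm.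
Qed.

Lemma fan_bound_le (R : realType) (X : Type) (d : semimetric R X) r (F F' : R) :
  fan_bound d r F -> F <= F' -> fan_bound d r F'.
Proof. by move=> H FF x y z h1 h2 h3; apply: dist_leW (H x y z h1 h2 h3) FF. Qed.

Lemma geodesic_point_close (R : realType) (X : Type) (d : semimetric R X)
    (delta F G H : R) (k0 n : nat) : 0 <= delta -> 0 <= F ->
  has_segments d -> thin_segments d delta ->
  fan_bound d (2 * delta) F -> fan_bound (dual d) (2 * delta) F ->
  fan_bound d (delta + 1) G -> 0 <= G ->
  fan_bound (dual d) (spread delta F) H -> 0 <= H ->
  log_radius delta F k0 + delta + H < n%:R ->
  spread delta F + n%:R * (G + 1) + delta <= 2 ^+ k0 ->
  forall (x u p q : X) (r rho w : R) (k : nat) (P1 P2 : curve R X) (Z : set X),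
  geodesic d P1 -> geodesic d P2 -> endpoint P2 x ->
  geodesic_point d P1 x rho u -> image_of P1 p -> image_of P2 q ->
  chain d Z w p q -> w <= 2 ^+ k ->
  (forall z, Z z -> ~ (d x z <= (rho + r)%:E)%E /\ ~ (d z x <= (rho + r)%:E)%E) ->
  (r = 0 /\ k = k0) \/ spread delta F + log_radius delta F k <= r ->
  close_to d (2 ^+ k0) u (image_of P2).
Proof.
move=> delta0 F0 geo thin fan fan' fanG G0 fanH H0 nk0 k0E.
move=> x u p q r rho w k P1 P2 Z /geodesic_segment[g1 [L1 [sg1 g10 g1L im1]]].
move=> /geodesic_segment[g2 [L2 [sg2 g20 g2L ->]]] P2x gp.
rewrite im1 => -[tp /= tpL gp1] P2q c wk far rk.
have {}P2x : x = g2 0 \/ x = g2 L2 by rewrite g20 g2L.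
have [h [M [sh jh hsub]]] := segment_from_end sg2 P2x P2q.
have K1 : 1 <= spread delta F by rewrite /spread; lra.
have dK : delta <= spread delta F by rewrite /spread; lra.
have rad0 j : 0 <= log_radius delta F j.
  by rewrite /log_radius addr_ge0// mulr_ge0 ?ler0n//; lra.
have radk0 := rad0 k0; have radk := rad0 k.
have nG0 : 0 <= n%:R * G by rewrite mulr_ge0 ?ler0n.
rewrite mulrDr mulr1 in k0E.
have r0 : 0 <= r by case: rk => [[-> _]|?]; lra.
have [gam [N [sgam gam0 gamN]]] := geo _ _ (dist_fin (chain_dist c)).
have [farx farx'] : (forall z, Z z -> ~ (d x z <= (rho + r)%:E)%E) /\
    (forall z, Z z -> ~ (d z x <= (rho + r)%:E)%E).
  by split=> z /far[].
have [Zp _] := chain_ends c.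
case: gp => rho0 _; rewrite im1 -g10 -g1L => -[tu /= tuL gu].
case=> [[g1x xu]|[g1x xu]].
  have tuE : tu = rho.
    move: xu; rewrite -g1x -gu (proj2 sg1)//; try lra.
    by rewrite subr0 => -[].
  (* The point [p] avoids the balls around [x], hence lies beyond [u]; only the part of [P1] from
     [x] to [p] enters the triangle. *)
  have tp_far : rho + r < tp.
    have [tpl|//] := lerP tp (rho + r); case: (farx p Zp).
    by rewrite -g1x -gp1; apply: (segment_le sg1); lra.
  have tp0 : 0 <= tp by lra.
  have sg := initial_segment sg1 tp0 (ltac:(lra)).
  have jh' : joins h M (g1 0) q by rewrite g1x.
  have gam0' : gam 0 = g1 tp by rewrite gp1.
  have tuL' : 0 <= tu <= tp by lra.
  rewrite -gp1 in c; rewrite -g1x in farx.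
  case: rk => [[r_eq k_eq]|rk]; rewrite -gu.
    rewrite r_eq addr0 -tuE in farx; rewrite k_eq in wk.
    apply: close_toW (lexx _) hsub.
    apply: (outgoing_near delta0 F0 geo thin fan sg sh sgam gamN wk gam0' jh' c farx
      tuL' fanG G0 fanH nk0).
    by rewrite mulrDr mulr1.
  have le : tu + spread delta F + log_radius delta F k <= rho + r by lra.
  apply: close_toW (outgoing_far delta0 F0 geo thin fan sg sh sgam gamN wk gam0' jh' c
    farx tuL' le) _ hsub.
  by lra.
have tuE : L1 - tu = rho.
  by move: xu; rewrite -g1x -gu (proj2 sg1) => [[]| | |]; lra.
have tp_far : rho + r < L1 - tp.
  have [tpl|//] := lerP (L1 - tp) (rho + r); case: (farx' p Zp).
  by rewrite -g1x -gp1; apply: (segment_le sg1); lra.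
have tp0 : 0 <= tp by lra.
have tpL1 : tp <= L1 by lra.
have sg := subsegment sg1 tp0 tpL1 (lexx L1).
set g := fun s => g1 (tp + s) in sg.
have g0 : g 0 = p by rewrite /g addr0.
have gL : g (L1 - tp) = x by rewrite /g addrC subrK.
have gu' : g (tu - tp) = u by rewrite /g addrC subrK.
have jh' : joins h M (g (L1 - tp)) q by rewrite gL.
have gam0' : gam 0 = g 0 by rewrite g0.
have tuL' : 0 <= tu - tp <= L1 - tp by lra.
rewrite -g0 in c; rewrite -gL in farx'.
case: rk => [[r_eq k_eq]|rk]; rewrite -gu'.
  have rhoE : rho = L1 - tp - (tu - tp) by lra.
  rewrite r_eq addr0 rhoE in farx'; rewrite k_eq in wk.
  apply: close_toW (incoming_near delta0 F0 geo thin fan' sg sh sgam gamN wk gam0' jh' c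
    farx' tuL') _ hsub.
  by lra.
have le : L1 - tp - (tu - tp) + delta + log_radius delta F k <= rho + r by lra.
apply: close_toW (incoming_far delta0 F0 geo thin fan' sg sh sgam gamN wk gam0' jh' c
  farx' tuL' le) _ hsub.
by lra.
Qed.

Theorem proposition5p1 (R : realType) (X : Type) (d : semimetric R X)
    (hgeod : geodesic_space d) (hhyp : hyperbolic d) (hB1 : B1 d) (hB2 : B2 d) :
  geodesics_diverge_exponentially d.
Proof.
have [delta delta0 /delta_hyperbolic_thin_segments thin] := hhyp.
have geo : has_segments d by move=> x y; exact: exists_segment.
have d20 : 0 <= 2 * delta by lra.
have [F1 F10 fan1] := B1_fan_bound hB1 d20.
have [F2 F20 fan2] := B2_fan_bound hB2 d20.
have [F F0 [fan fan']] : exists2 F, 0 <= F &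
    fan_bound d (2 * delta) F /\ fan_bound (dual d) (2 * delta) F.
  exists (F1 + F2); first lra.
  by split; [apply: fan_bound_le fan1 _|apply: fan_bound_le fan2 _]; lra.
have K1 : 1 <= spread delta F by rewrite /spread; lra.
have d1 : 0 <= delta + 1 by lra.
have K0 : 0 <= spread delta F by lra.
have [G G0 fanG] := B1_fan_bound hB1 d1.
have [H H0 fanH] := B2_fan_bound hB2 K0.
have [k0 [n [nk0 k0E]]] : exists k0 n : nat, log_radius delta F k0 + delta + H < n%:R /\
    spread delta F + n%:R * (G + 1) + delta <= 2 ^+ k0.
  (* With [n <= log_radius delta F k0 + delta + H + 1], the left side of the second inequality is at
     most linear in [k0], with these coefficients. *)
  have [k0 k0E] := linear_le_exp2 (spread delta F + delta + (2 + delta + H) * (G + 1))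
    (2 * spread delta F * (G + 1)).
  exists k0, (Num.trunc (log_radius delta F k0 + delta + H)).+1.
  split; first exact: truncnS_gt.
  have rad0 : 0 <= log_radius delta F k0 + delta + H.
    by rewrite /log_radius !addr_ge0// !mulr_ge0 ?ler0n//; lra.
  apply: le_trans k0E; have := truncn_itv rad0; rewrite -natr1 => /andP[h _].
  move: (Num.trunc _)%:R h => m h.
  have : (m + 1) * (G + 1) <= (log_radius delta F k0 + delta + H + 1) * (G + 1).
    by apply: ler_wpM2r; lra.
  by rewrite /log_radius; move: (k0%:R : R) => z; lra.
have key := geodesic_point_close delta0 F0 geo thin fan fan' fanG G0 fanH H0 nk0 k0E.
(* For these [a] and [c], the condition [k <= (r - a) / c] is exactly [spread delta F + log_radius
   delta F k <= r]. *)
have [a aE] : exists a : R, a = spread delta F + 1 by eexists.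
have [c cE] : exists c : R, c = 2 * spread delta F by eexists.
(* The value [- 1] lies below every length, so nothing has to be shown for nonzero [r < a], negative
   [r] included. *)
pose e (r : R) : R := if r == 0 then 2 ^+ k0 else
  if r < a then - 1 else 2 ^+ Num.trunc ((r - a) / c).
have a0 : 0 < a by lra.
have c0 : 0 < c by lra.
exists e; split; last first.
  apply: (exponential_truncn (a := a) c0) => r ar; rewrite /e (gt_eqF (lt_le_trans a0 ar)).
  by case: ltrP => // ra; have := le_lt_trans ar ra; rewrite ltxx.
move=> x P1 P2 geo1 geo2 _ P2x r rho u gp far Q [Qdir Q1 Q2] Qout.
rewrite ltNge; apply/negP => Qle.
have [w cw wQ] := directed_path_chain Qdir.
have we : w <= e r by rewrite -lee_fin; exact: le_trans Qle.
have w0 : 0 <= w by rewrite -lee_fin; apply: le_trans (chain_dist cw); exact: dist_ge0.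
have [k [wk rk]] : exists k, w <= 2 ^+ k /\
    ((r = 0 /\ k = k0) \/ spread delta F + log_radius delta F k <= r).
  move: we; rewrite /e; case: (eqVneq r 0) => [-> we|_]; first by exists k0; split => //; left.
  case: (ltrP r a) => [_|ar we]; first by lra.
  exists (Num.trunc ((r - a) / c)); split=> //; right.
  have : 0 <= (r - a) / c by rewrite divr_ge0 ?(ltW c0)// subr_ge0.
  move=> /truncn_itv /andP[]; rewrite ler_pdivlMr// => + _.
  by rewrite /log_radius cE aE; move: (_%:R : R) => z; lra.
have Qfar z : image_of Q z ->
    ~ (d x z <= (rho + r)%:E)%E /\ ~ (d z x <= (rho + r)%:E)%E.
  by move=> /Qout /= /not_orP[? ?]; split.
have [v P2v uv] := key x u _ _ r rho w k P1 P2 _ geo1 geo2 P2x gp Q1 Q2 cw wk Qfar rk.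
move: far; rewrite /e eqxx ltNge => /negP; apply; apply: le_trans uv.
by apply: ereal_inf_lbound; exists v.
Qed.
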